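(* There exist pairwise topologically conjugate continuous maps $P,S,T\colon[0,1]\to[0,1]$, sets $K,L,M\subset[0,1]$ and positive numbers $\delta_d$ ($d\ge2$) such that: (1) $K,L,M$ have full Lebesgue measure; (2) for every $d\ge2$, every $d$-tuple of pairwise distinct points of $L$ is $\delta_d$-Li-Yorke for $S$, and every $d$-tuple of pairwise distinct points of $M$ is $\delta_d$-Li-Yorke for $T$; (3) $\omega(x,S)=[0,1]$ for every $x\in L$; (4) there is a Cantor set $A$ of positive Lebesgue measure which is a minimal set for $T$ such that $\omega(x,T)=A$ for every $x\in M$; (5) no pair $(x,y)\in K\times K$ is Li-Yorke for $P$; in particular the set of Li-Yorke pairs of $P$ has zero two-dimensional Lebesgue measure.
   Context: For a continuous map $f$ on $[0,1]$ with metric $\rho(x,y)=|x-y|$, a $d$-tuple $(x_1,\dots,x_d)$ is proximal if $\liminf_n\max_{i,j}\rho(f^n x_i,f^n x_j)=0$, $\delta$-separated if $\limsup_n\min_{i\ne j}\rho(f^n x_i,f^n x_j)>\delta$, Li-Yorke if proximal and $\delta$-separated for some $\delta>0$, and $\delta$-Li-Yorke if proximal and $\delta$-separated. $\omega(x,f)$ is the $\omega$-limit set of $x$. A minimal set is a nonempty closed invariant set with no proper nonempty closed invariant subset. *)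

(* Defs.v *)
From Stdlib Require Import Reals Lra.
Open Scope R_scope.

Definition I01 (x : R) : Prop := 0 <= x <= 1.

Fixpoint iter (n : nat) (f : R -> R) (x : R) : R :=
  match n with O => x | S k => f (iter k f x) end.

Definition cont01 (f : R -> R) : Prop :=
  forall x, I01 x -> forall eps, eps > 0 -> exists del, del > 0 /\
    forall y, I01 y -> Rabs (y - x) < del -> Rabs (f y - f x) < eps.

Definition cmap01 (f : R -> R) : Prop :=
  cont01 f /\ forall x, I01 x -> I01 (f x).

Definition top_conj (f g : R -> R) : Prop :=
  exists h hinv : R -> R,
    cmap01 h /\ cmap01 hinv /\
    (forall x, I01 x -> hinv (h x) = x) /\
    (forall y, I01 y -> h (hinv y) = y) /\
    (forall x, I01 x -> h (f x) = g (h x)).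

Definition proximal (f : R -> R) (d : nat) (x : nat -> R) : Prop :=
  forall eps, eps > 0 -> forall N : nat, exists n : nat, (n >= N)%nat /\
    forall i j, (i < d)%nat -> (j < d)%nat ->
      Rabs (iter n f (x i) - iter n f (x j)) < eps.

(* limsup_n min_{i<>j} |f^n x_i - f^n x_j| > delta *)
Definition separated (f : R -> R) (d : nat) (x : nat -> R) (delta : R) : Prop :=
  exists eta, eta > delta /\ forall N : nat, exists n : nat, (n >= N)%nat /\
    forall i j, (i < d)%nat -> (j < d)%nat -> i <> j ->
      Rabs (iter n f (x i) - iter n f (x j)) > eta.

Definition delta_LiYorke (f : R -> R) (d : nat) (x : nat -> R) (delta : R) : Prop :=
  proximal f d x /\ separated f d x delta.

Definition LiYorke (f : R -> R) (d : nat) (x : nat -> R) : Prop :=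
  proximal f d x /\ exists delta, delta > 0 /\ separated f d x delta.

Definition pair2 (x y : R) : nat -> R := fun i => match i with O => x | _ => y end.

Definition LiYorke_pair (f : R -> R) (x y : R) : Prop := LiYorke f 2 (pair2 x y).

Definition omega_limit (f : R -> R) (x : R) (y : R) : Prop :=
  forall eps, eps > 0 -> forall N : nat, exists n : nat, (n >= N)%nat /\
    Rabs (iter n f x - y) < eps.

Definition closed_set (A : R -> Prop) : Prop :=
  forall y, (forall eps, eps > 0 -> exists a, A a /\ Rabs (a - y) < eps) -> A y.

Definition invariant (f : R -> R) (A : R -> Prop) : Prop :=
  forall x, A x -> A (f x).

Definition minimal_set (f : R -> R) (A : R -> Prop) : Prop :=
  (exists a, A a) /\ closed_set A /\ invariant f A /\
  forall B : R -> Prop, (exists b, B b) -> closed_set B -> invariant f B ->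
    (forall x, B x -> A x) -> forall x, A x -> B x.

(* Cantor set in [0,1]: nonempty, closed, perfect, totally disconnected
   (for subsets of R: contains no nondegenerate interval). *)
Definition cantor_set (A : R -> Prop) : Prop :=
  (exists a, A a) /\ (forall x, A x -> I01 x) /\ closed_set A /\
  (forall x, A x -> forall eps, eps > 0 -> exists y, A y /\ y <> x /\ Rabs (y - x) < eps) /\
  (forall a b, a < b -> exists z, a < z < b /\ ~ A z).

Definition null1 (E : R -> Prop) : Prop :=
  forall eps, eps > 0 -> exists a b : nat -> R,
    (forall n, a n <= b n) /\
    (forall x, E x -> exists n, a n <= x <= b n) /\
    (forall N, sum_f_R0 (fun n => b n - a n) N <= eps).

Definition null2 (E : R -> R -> Prop) : Prop :=
  forall eps, eps > 0 -> exists a b c e : nat -> R,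
    (forall n, a n <= b n /\ c n <= e n) /\
    (forall x y, E x y -> exists n, a n <= x <= b n /\ c n <= y <= e n) /\
    (forall N, sum_f_R0 (fun n => (b n - a n) * (e n - c n)) N <= eps).

Definition full_measure01 (K : R -> Prop) : Prop :=
  (forall x, K x -> I01 x) /\ null1 (fun x => I01 x /\ ~ K x).

Definition positive_measure (A : R -> Prop) : Prop := ~ null1 A.

(* Main.v *)
Require Import Defs.
From Stdlib Require Import Reals Lra Lia Classical ClassicalEpsilon FunctionalExtensionality.
From mathcomp Require all_boot zify.
From Corelib Require Import ssreflect ssrfun ssrbool.
Open Scope R_scope.

(** All three maps are conjugate to the three-branch zigzag map [zig] of slope 3, by homeomorphisms
    that give full measure to three suitable sets of points of [zig].  Each of these sets is a
    countable union of Cantor sets, one at least in each interval; a Cantor set consists of the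
    points whose itinerary is a fixed word followed by a sequence [v c], where the label [c] runs
    over the 0-1 sequences with a given initial word.  Such a union acquires full measure under the
    distribution function of a mixture of coin-tossing measures.

    For [K] the sequence [v c] is of Toeplitz type: it has the symbol [2 c_k] at all places [n] with
    [n+1 = 2^k * odd], so that two such sequences are equal or differ with bounded gaps.  For [L]
    and [M] it is the limit of words [W_k(c)], [W_(k+1)(c)] being a concatenation of the words
    [W_k(phi(c))] over all maps [phi] from labels of length [k+1] to labels of length [k+1].  The
    constant maps [phi] give proximality (and minimality), the maps [phi] taking [d] prescribed
    labels to [d] fixed distinct ones give a separation that depends on [d] only.  For [L] all words
    are inserted in addition, which makes the orbits dense; for [M] one of the
    Cantor sets lies in the minimal set, which thereby gets positive measure. *)

(** * Symbol families *)

(** Measure and dynamics meet only in the labels. All Cantor sets of a family use the same map [v],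
    and a label determines its point among all of them, so that points of different Cantor sets are
    compared like points of one; the words put in front place the sets in every interval and do not
    matter in the long run. A distribution function needs points that increase with the label in the
    lexicographic order, but the middle branch of [zig] reverses the order: hence label bits are
    written with 0 and 2, and each place where a bit first shows is preceded by an even number of
    1s. The mixture of the distribution functions is itself the homeomorphism; no measure is built.
    On an interval that misses the first N Cantor sets the first N summands are constant, so that
    only the rest, of total weight 2^-N, contributes to the length of the image. A conjugacy
    distorts distances, but uniformly: therefore the separation for [zig] has to be bounded below by
    a constant that depends on [d] alone. *)

Definition agree (n : nat) (y y' : nat -> bool) : Prop :=
  forall k, (k < n)%nat -> y k = y' k.

(** The orientation of the first [n] inverse branches of [zig] coded by [u]: only the middle one
    decreases. *)
Fixpoint odd_ones (u : nat -> nat) (n : nat) : bool :=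
  match n with O => false | S k => xorb (odd_ones u k) (Nat.eqb (u k) 1) end.

(** Made for monotonicity in the label: the first differing bit [k] shows first at the place [l k],
    as 0 against 2, behind an even number of 1s. *)
Record symbol_family (v : (nat -> bool) -> nat -> nat) (l : nat -> nat) : Prop := {
  sf_incr : forall k, (l k < l (S k))%nat;
  sf_agree : forall k y y', agree k y y' ->
    forall n, (n < l k)%nat -> v y n = v y' n;
  sf_bit : forall k y, v y (l k) = if y k then 2%nat else 0%nat;
  sf_even : forall k y, odd_ones (v y) (l k) = false;
  sf_le2 : forall y n, (v y n <= 2)%nat }.

(** The place [o] serves all labels at once, so that the orbits of a whole tuple are controlled at
    the same time. *)
Definition block_prop (v : (nat -> bool) -> nat -> nat) : Prop :=
  forall K (phi : (nat -> bool) -> nat -> bool),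
  (forall y y', agree K y y' -> agree K (phi y) (phi y')) ->
  exists o, (K <= o)%nat /\
    forall y r, (r < K)%nat -> v y (o + r)%nat = v (phi y) r.

Module Words.
Import all_boot zify.
Set Implicit Arguments.
Unset Strict Implicit.
Local Open Scope nat_scope.

Definition restr (n : nat) (y : nat -> bool) : n.-tuple bool := [tuple y i | i < n].
Definition ext (n : nat) (t : n.-tuple bool) : nat -> bool := nth false t.

Lemma restrE n y k : k < n -> nth false (restr n y) k = y k.
Proof.
move=> h; rewrite -[k]/(nat_of_ord (Ordinal h)) -tnth_nth tnth_mktuple //.
Qed.

Lemma restr_agree n y y' : agree n y y' -> restr n y = restr n y'.
Proof. by move=> h; apply: eq_mktuple => i; apply: h; apply/ltP. Qed.

Lemma all_flatten_map (T : Type) (s : seq T) (F : T -> seq nat) p :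
  (forall x, all p (F x)) -> all p (flatten [seq F x | x <- s]).
Proof. by move=> h; elim: s => //= x s IH; rewrite all_cat h. Qed.

Lemma even_count_flatten_map (T : Type) (s : seq T) (F : T -> seq nat) p :
  (forall x, ~~ odd (count p (F x))) -> ~~ odd (count p (flatten [seq F x | x <- s])).
Proof. by move=> h; elim: s => //= x s IH; rewrite count_cat oddD (negbTE (h x)). Qed.

Lemma flatten_flatten_map (T U : Type) (s : seq T) (F : T -> seq nat) (G : U -> seq nat) :
  (forall x, exists r, F x = flatten [seq G z | z <- r]) ->
  exists r, flatten [seq F x | x <- s] = flatten [seq G z | z <- r].
Proof.
move=> h; elim: s => [|x s [r2 /= ->]]; first by exists [::].
by have [r1 ->] := h x; exists (r1 ++ r2); rewrite map_cat flatten_cat.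
Qed.

(** * Words containing a block for every map of labels *)

Section Recursion.
Variable e : nat -> seq nat.

(* The block [W K' (fun=> y K'.+1)] records the new bit: it starts with 2 or 0 according to it,
   so that the first difference of two labels is seen at the place [size (W K' y)]. *)
Fixpoint W (K : nat) (y : nat -> bool) : seq nat :=
  match K with
  | 0 => [:: if y 0 then 2 else 0]
  | K'.+1 => W K' y ++ W K' (fun=> y K'.+1) ++
      flatten [seq W K' (ext (phi (restr K'.+1 y)))
              | phi : {ffun K'.+1.-tuple bool -> K'.+1.-tuple bool}] ++ e K'
  end.

Lemma W_agree K y y' : agree K.+1 y y' -> W K y = W K y'.
Proof.
elim: K y y' => [|K IH] y y' h /=; first by rewrite h //; apply/ltP.
have h' : agree K.+1 y y' by move=> k hk; apply: h; lia.
rewrite (IH _ _ h') (h K.+1) ?(restr_agree h') //; lia.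
Qed.

Lemma size_flatten_unif (T : Type) (s : seq T) (F G : T -> seq nat) :
  (forall x, size (F x) = size (G x)) ->
  size (flatten [seq F x | x <- s]) = size (flatten [seq G x | x <- s]).
Proof. by move=> h; elim: s => //= x s IH; rewrite !size_cat h IH. Qed.

Lemma size_W K y y' : size (W K y) = size (W K y').
Proof.
elim: K y y' => [|K IH] y y' //=.
rewrite !size_cat (IH y y') (IH (fun=> y K.+1) (fun=> y' K.+1)).
by congr (_ + (_ + (_ + _))); apply: size_flatten_unif => phi.
Qed.

Definition len K := size (W K (fun=> false)).

Lemma lenE K y : size (W K y) = len K. Proof. exact: size_W. Qed.

Lemma lenS K : len K.+1 >= len K + len K.
Proof. rewrite -(lenE K.+1 (fun=> false)) /= !size_cat !lenE; lia. Qed.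

Lemma len_gt K : K < len K.
Proof. elim: K => // K IH; have := lenS K; lia. Qed.

Definition v (y : nat -> bool) (n : nat) : nat := nth 0 (W n y) n.

Lemma W_prefix K j y n : n < len K -> nth 0 (W (K + j) y) n = nth 0 (W K y) n.
Proof.
move=> hn; elim: j => [|j IH]; first by rewrite addn0.
rewrite addnS /= nth_cat lenE -IH.
have -> // : n < len (K + j).
apply: leq_trans hn _; elim: (j) => [|i]; first by rewrite addn0.
rewrite addnS; have := lenS (K + i); lia.
Qed.

Lemma v_W K y n : n < len K -> v y n = nth 0 (W K y) n.
Proof.
move=> hn; rewrite /v; case: (leqP n K) => h.
- by rewrite -(subnKC h) W_prefix ?subnKC // len_gt.
- by rewrite -{1}(subnKC (ltnW h)) W_prefix.
Qed.

(** The map [phi] is among those enumerated in [W K.+1]; words of one level have one length, so that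
    its block starts at the same place for all labels. *)
Lemma W_block K (phi : {ffun K.+1.-tuple bool -> K.+1.-tuple bool}) :
  exists o, [/\ len K <= o, o + len K <= len K.+1 &
    forall y r, r < len K -> v y (o + r) = v (ext (phi (restr K.+1 y))) r].
Proof.
have /= hphi : phi \in enum {: {ffun K.+1.-tuple bool -> K.+1.-tuple bool}}.
  by rewrite mem_enum.
pose B y (s : seq {ffun K.+1.-tuple bool -> K.+1.-tuple bool}) :=
  flatten (map (fun f : {ffun K.+1.-tuple bool -> K.+1.-tuple bool} =>
      W K (ext (f (restr K.+1 y)))) s).
have BE y y' s : size (B y s) = size (B y' s).
  by apply: size_flatten_unif => f; exact: size_W.
case/path.splitPr Ephi: _ / hphi => [s1 s2].
pose z : nat -> bool := fun=> false.
have dec y : W K.+1 y = (W K y ++ W K (fun=> y K.+1) ++ B y s1) ++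
    W K (ext (phi (restr K.+1 y))) ++ (B y s2 ++ e K).
  rewrite /= /image_mem Ephi map_cat flatten_cat /= -!catA. by [].
(* Two words of level [K] precede the blocks; then come the blocks of the maps listed before
   [phi]. *)
exists (len K + len K + size (B z s1)).
have hsz y : size (W K y ++ W K (fun=> y K.+1) ++ B y s1) =
  len K + len K + size (B z s1) by rewrite !size_cat !lenE (BE y z) addnA.
have hle : len K + len K + size (B z s1) + len K <= len K.+1.
  rewrite -(lenE K.+1 z) dec size_cat hsz size_cat lenE; lia.
split=> //; first by lia.
move=> y r hr; rewrite (@v_W K.+1); last by lia.
rewrite dec nth_cat hsz ltnNge leq_addr /= addKn nth_cat lenE hr.
by rewrite -v_W.
Qed.

Lemma v_block K (phi : (nat -> bool) -> nat -> bool) :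
  (forall y y', agree K y y' -> agree K (phi y) (phi y')) ->
  exists o, [/\ K <= o, o + K <= len K.+1 &
    forall y r, r < K -> v y (o + r) = v (phi y) r].
Proof.
move=> hphi.
pose f := [ffun t : K.+1.-tuple bool => restr K.+1 (phi (ext t))].
have [o [h1 h2 h3]] := W_block f.
exists o; have hK := len_gt K; split; [lia | lia |] => y r hr.
rewrite h3 ?ffunE; last by lia.
(* [W K] reads [K+1] bits, one more than [phi] respects. As [r < K], words of the level below
   suffice; [K = 0] is vacuous. *)
case: K hphi f o h1 h2 h3 hK hr => [//|K] hphi f o h1 h2 h3 hK hr.
rewrite !(@v_W K); try (have := len_gt K; lia).
congr (nth 0 _ r); apply: W_agree => k hk.
rewrite /ext restrE; last by lia.
apply: (hphi) => // j hj; rewrite restrE //; lia.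
Qed.

Lemma v_e K : exists o, forall y r, r < size (e K) -> v y (o + r) = nth 0 (e K) r.
Proof.
pose z : nat -> bool := fun=> false.
exists (len K.+1 - size (e K)) => y r hr.
have hle : size (e K) <= len K.+1 by rewrite -(lenE K.+1 z) /= !size_cat; lia.
rewrite (@v_W K.+1); last by lia.
have := lenE K.+1 y; rewrite /= !catA size_cat => hs.
rewrite nth_cat -hs addnK ltnNge leq_addr /=; congr nth; lia.
Qed.

Hypothesis e_le2 : forall K, all (fun a => a <= 2) (e K).
Hypothesis e_even : forall K, ~~ odd (count_mem 1 (e K)).

Lemma W_le2 K y : all (fun a => a <= 2) (W K y).
Proof.
elim: K y => [|K IH] y /=; first by case: (y 0).
rewrite !all_cat !IH e_le2 /= andbT.
by apply: all_flatten_map => f; exact: IH.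
Qed.

Lemma W_even K y : ~~ odd (count_mem 1 (W K y)).
Proof.
elim: K y => [|K IH] y /=; first by case: (y 0).
rewrite !count_cat !oddD (negbTE (IH _)) (negbTE (IH _)) (negbTE (e_even _)) /= addbF.
by apply: even_count_flatten_map => f; exact: IH.
Qed.

Definition first_diff k := if k is k'.+1 then len k' else 0.

Lemma odd_ones_nth (u : nat -> nat) s n : n <= size s ->
  (forall i, i < n -> u i = nth 0 s i) -> odd_ones u n = odd (count_mem 1 (take n s)).
Proof.
elim: n => [|n IH] hn hu; first by rewrite take0.
rewrite /= IH ?hu //; [|lia|by move=> i hi; apply: hu; lia].
rewrite (take_nth 0) // -cats1 count_cat oddD /= addn0.
by case: (odd _) (nth 0 s n) => [] [|[|?]].
Qed.

Lemma v_family : symbol_family v first_diff.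
Proof.
split.
- case=> [|k]; rewrite /first_diff; [have := len_gt 0 | have := len_gt k; have := lenS k]; lia.
- case=> [|k] y y' h n /= hn; first by lia.
  by rewrite !(@v_W k) ?(W_agree h) //; lia.
- case=> [|k] y; first by rewrite /v.
  rewrite /= (@v_W k.+1); last by (have := lenS k; have := len_gt k; lia).
  rewrite /= nth_cat lenE ltnn subnn nth_cat lenE.
  have -> : 0 < len k by have := len_gt k; lia.
  by rewrite -v_W //; have := len_gt k; lia.
- case=> [|k] y //=.
  rewrite (@odd_ones_nth _ (W k y)) ?lenE //; last by move=> i; exact: v_W.
  by rewrite -(lenE k y) take_size (negbTE (W_even _ _)).
- move=> y n; apply/leP.
  have := W_le2 n y; move/all_nthP => /(_ 0 n); rewrite lenE => h; apply: h; exact: len_gt.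
Qed.

End Recursion.

(** * Uniform recurrence in the absence of inserted words *)

Lemma v_blocks_aligned K T y : K <= T ->
  exists ss, W (fun=> [::]) T y = flatten [seq W (fun=> [::]) K z | z <- ss].
Proof.
move=> /subnKC <-; elim: (T - K) y => [|j IH] y.
  by exists [:: y]; rewrite addn0 /= cats0.
rewrite addnS /= cats0.
have [s1 ->] := IH y; have [s2 ->] := IH (fun=> y (K + j).+1).
have [s3 ->] : exists s3, flatten [seq W (fun=> [::]) (K + j) (ext (phi (restr (K + j).+1 y)))
    | phi : {ffun (K + j).+1.-tuple bool -> (K + j).+1.-tuple bool}]
    = flatten [seq W (fun=> [::]) K z | z <- s3].
  by apply: flatten_flatten_map => f; exact: IH.
by exists (s1 ++ s2 ++ s3); rewrite !map_cat !flatten_cat.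
Qed.

Lemma nth_flatten_unif (T : Type) (F : T -> seq nat) L x0 ss m r :
  (forall x, size (F x) = L) -> m < size ss -> r < L ->
  nth 0 (flatten [seq F x | x <- ss]) (m * L + r) = nth 0 (F (nth x0 ss m)) r.
Proof.
move=> hF; elim: ss m => //= x ss IH [|m] hm hr; rewrite nth_cat hF /=; first by rewrite hr.
rewrite mulSn -addnA ltnNge leq_addr /= addKn; exact: IH.
Qed.

Lemma v_aligned K y m : exists z, forall r, r < len (fun=> [::]) K ->
  v (fun=> [::]) y (m * len (fun=> [::]) K + r) = v (fun=> [::]) z r.
Proof.
set e : nat -> seq nat := fun=> [::]; set L := len e K.
have hL : K < L := len_gt e K.
have [ss hss] := @v_blocks_aligned K (K + m.+1 * L) y (leq_addr _ _).
pose y0 : nat -> bool := fun=> false.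
exists (nth y0 ss m) => r hr.
have hlen : m.+1 * L < len e (K + m.+1 * L) by have := len_gt e (K + m.+1 * L); lia.
have hm : m < size ss.
  move: hlen; rewrite -(lenE e _ y) -/e hss.
  have -> : size (flatten [seq W e K z | z <- ss]) = size ss * L.
    by elim: (ss) => //= z s IH; rewrite size_cat IH lenE mulSn.
  rewrite ltn_mul2r; lia.
rewrite (@v_W _ (K + m.+1 * L)); last by (rewrite -/e; lia).
rewrite -/e hss (nth_flatten_unif y0 _ hm hr); last by move=> x; exact: lenE.
by rewrite (@v_W _ K).
Qed.

(** From any place an aligned word of level [K+1] starts within [L] steps, and it contains the start
    of [v y'], since the constant map to [y'] is among its maps. The bound depends on [K] only, so
    all labels share one limit set. *)
Lemma v_recurrent K : exists R, forall y y' n, exists j, j <= R /\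
  forall r, r < K -> v (fun=> [::]) y (n + j + r) = v (fun=> [::]) y' r.
Proof.
set e : nat -> seq nat := fun=> [::]; set L := len e K.+1.
exists (2 * L) => y y' n.
have [o [ho1 ho2 ho]] := @v_block e K (fun=> y') (fun _ _ _ _ _ => erefl).
have [z hz] := @v_aligned K.+1 y (n %/ L).+1.
have hL : K.+1 < L := len_gt e K.+1.
have hn := divn_eq n L.
have hmod : n %% L < L by rewrite ltn_mod; lia.
exists ((n %/ L).+1 * L + o - n); rewrite -/L in ho2; rewrite -/e -/L in hz *.
have hmul : (n %/ L).+1 * L = n %/ L * L + L by rewrite mulSn addnC.
split=> [|r hr]; first by lia.
have -> : n + ((n %/ L).+1 * L + o - n) + r = (n %/ L).+1 * L + (o + r) by lia.
rewrite hz; [exact: ho | lia].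
Qed.

(** * Enumerations of finite words *)

Definition word (n : nat) : seq nat :=
  if unpickle n is Some w then if all (fun a => a <= 2) w then w else [::] else [::].

Lemma word_pickle (w : seq nat) : all (fun a => a <= 2) w -> word (pickle w) = w.
Proof. by rewrite /word pickleK => ->. Qed.

Lemma word_le2 n : all (fun a => a <= 2) (word n).
Proof. by rewrite /word; case: unpickle => // w; case: ifP. Qed.

(* Doubling makes the number of 1s even, so that the branches of [zig] coded by the words [W]
   are increasing. *)
Definition dbl_word (n : nat) : seq nat := word n ++ word n.

Lemma dbl_word_le2 n : all (fun a => a <= 2) (dbl_word n).
Proof. by rewrite all_cat word_le2. Qed.

Lemma dbl_word_even n : ~~ odd (count_mem 1 (dbl_word n)).
Proof. by rewrite count_cat oddD addbb. Qed.

Lemma v_words (w : nat -> nat) N m : (forall n, w n <= 2) ->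
  exists o, N <= o /\ forall y r, r < m -> v dbl_word y (o + r) = w r.
Proof.
(* The leading zeros push the occurrence of [w] beyond the place [N]. *)
move=> hw; pose s := nseq N 0 ++ mkseq w m.
have hs : all (fun a => a <= 2) s.
  rewrite all_cat all_nseq orbT /=; apply/(all_nthP 0) => i; rewrite size_mkseq => hi.
  by rewrite nth_mkseq.
have [o ho] := @v_e dbl_word (pickle s).
exists (o + N); split=> [|y r hr]; first exact: leq_addl.
have hsz : size s = N + m by rewrite size_cat size_nseq size_mkseq.
have hd : dbl_word (pickle s) = s ++ s by rewrite /dbl_word word_pickle.
rewrite -addnA ho; last by rewrite hd size_cat hsz; lia.
rewrite hd nth_cat hsz ltn_add2l hr nth_cat size_nseq ltnNge leq_addr /= addKn.
by rewrite nth_mkseq.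
Qed.

Definition even_word (n : nat) : seq nat :=
  if odd (count_mem 1 (word n)) then [::] else word n.

Lemma even_word_pickle (w : nat -> nat) m : (forall n, w n <= 2) ->
  odd_ones w m = false -> even_word (pickle (mkseq w m)) = mkseq w m.
Proof.
move=> hw; rewrite /even_word word_pickle; last first.
  by apply/(all_nthP 0) => i; rewrite size_mkseq => hi; rewrite nth_mkseq.
rewrite (@odd_ones_nth _ (mkseq w m)) ?size_mkseq //; last by move=> i hi; rewrite nth_mkseq.
by rewrite take_oversize ?size_mkseq // => ->.
Qed.

Lemma even_word_even n : odd_ones (nth 0 (even_word n)) (size (even_word n)) = false.
Proof.
rewrite (@odd_ones_nth _ (even_word n)) // take_size /even_word.
by case: ifP.
Qed.

(** * Toeplitz sequences *)

Definition toeplitz (y : nat -> bool) (n : nat) : nat := if y (logn 2 n.+1) then 2 else 0.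

(** The first [n] for which [n+1] has 2-adic valuation [k] is [2^k - 1]; the symbol 1 never
    occurs. *)
Lemma toeplitz_family : symbol_family toeplitz (fun k => (2 ^ k).-1).
Proof.
have hpos k : 0 < 2 ^ k by rewrite expn_gt0.
have odd0 y n : odd_ones (toeplitz y) n = false.
  by elim: n => //= n ->; rewrite /toeplitz; case: (y _).
split=> //.
- by move=> k; have := hpos k; rewrite expnS; lia.
- move=> k y y' h n hn; rewrite /toeplitz h //; apply/ltP.
  rewrite -(ltn_exp2l _ _ (ltnSn 1)).
  apply: leq_ltn_trans (_ : n.+1 < _); last by have := hpos k; lia.
  by apply: dvdn_leq => //; exact: pfactor_dvdnn.
- by move=> k y; rewrite /toeplitz prednK // pfactorK.
- by move=> y n; rewrite /toeplitz; case: (y _); lia.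
Qed.

(** The places that carry the bit [k] form an arithmetic progression of difference [2^(k+1)]. *)
Lemma toeplitz_distal y y' k : y k <> y' k ->
  exists R, forall n, exists j, j <= R /\ toeplitz y (n + j) <> toeplitz y' (n + j).
Proof.
move=> hk; exists (2 * 2 ^ k.+1) => n.
have hpos : 0 < 2 ^ k by rewrite expn_gt0.
have [q [t [hn ht]]] : exists q t, n = q * (2 * 2 ^ k) + t /\ t < 2 * 2 ^ k.
  exists (n %/ (2 * 2 ^ k)), (n %% (2 * 2 ^ k)); split; first exact: divn_eq.
  by rewrite ltn_mod; lia.
have hlog : logn 2 (2 ^ k * (q.+1 * 2).+1) = k.
  rewrite lognM // pfactorK // logn_coprime ?addn0 //.
  by rewrite prime_coprime // dvdn2 /= oddM andbF.
(* The odd multiple [2^k * (2q+3)] exceeds [n], because [n < 2^k * (2q+2)]. *)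
exists ((2 ^ k * (q.+1 * 2).+1).-1 - n).
have hle : n < 2 ^ k * (q.+1 * 2).+1 <= n + 4 * 2 ^ k.
  by move: (2 ^ k) hn ht hpos => P -> *; nia.
split; first by rewrite expnS; lia.
have -> : n + ((2 ^ k * (q.+1 * 2).+1).-1 - n) = (2 ^ k * (q.+1 * 2).+1).-1 by lia.
rewrite /toeplitz prednK ?hlog; last by lia.
by case: (y k) (y' k) hk => [] [].
Qed.

Lemma transitive_family : exists v l, symbol_family v l /\ block_prop v /\
  forall w : nat -> nat, (forall n, (w n <= 2)%coq_nat) -> forall N m,
  exists o, (N <= o)%coq_nat /\ forall y r, (r < m)%coq_nat -> v y (o + r)%coq_nat = w r.
Proof.
exists (v dbl_word), (first_diff dbl_word); split; [|split].
- exact: v_family dbl_word_le2 dbl_word_even.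
- move=> K phi /(@v_block dbl_word) [o [h1 _ h2]]; exists o; split; first by apply/leP.
  by move=> y r /ltP hr; exact: h2.
- move=> w hw N m; have [n|o [h1 h2]] := @v_words w N m; first exact/leP.
  by exists o; split; [exact/leP | move=> y r /ltP; exact: h2].
Qed.

Lemma minimal_family : exists v l, symbol_family v l /\ block_prop v /\
  (forall y n, v y n <> 1%coq_nat) /\
  forall K, exists R, forall y y' n, exists j, (j <= R)%coq_nat /\
    forall r, (r < K)%coq_nat -> v y (n + j + r)%coq_nat = v y' r.
Proof.
pose e : nat -> list nat := fun _ => nil.
exists (v e), (first_diff e); split; [|split; [|split]].
- exact: v_family.
- move=> K phi /(@v_block e) [o [h1 _ h2]]; exists o; split; first by apply/leP.
  by move=> y r /ltP hr; exact: h2.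
- move=> y n; have [z hz] := v_aligned 0 y n.
  have := hz 0%coq_nat isT; rewrite /len /= muln1 addn0 => ->.
  by rewrite /v /=; case: (z _).
- move=> K; have [R hR] := v_recurrent K; exists R => y y' n.
  have [j [h1 h2]] := hR y y' n; exists j; split; first by apply/leP.
  by move=> r /ltP; exact: h2.
Qed.

Lemma distal_family : exists v l, symbol_family v l /\ (forall y n, v y n <> 1%coq_nat) /\
  forall y y' k, y k <> y' k -> exists R, forall n, exists j, (j <= R)%coq_nat /\
    v y (n + j)%coq_nat <> v y' (n + j)%coq_nat.
Proof.
exists toeplitz, (fun k => (2 ^ k).-1); split; [|split].
- exact: toeplitz_family.
- by move=> y n; rewrite /toeplitz; case: (y _).
- move=> y y' k /toeplitz_distal [R hR]; exists R => n.
  by have [j [h1 h2]] := hR n; exists j; split; [exact/leP |].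
Qed.

(** The prefixes of the Cantor sets: even words, and zeros beyond them, so that neither word nor
    padding reverses the orientation. *)
Lemma even_words : exists (p : nat -> nat -> nat) (sz : nat -> nat),
  (forall i, odd_ones (p i) (sz i) = false) /\
  (forall i n, (sz i <= n)%coq_nat -> p i n = 0%coq_nat) /\
  forall w m, (forall n, (w n <= 2)%coq_nat) -> odd_ones w m = false ->
    exists i, sz i = m /\ forall r, (r < m)%coq_nat -> p i r = w r.
Proof.
exists (fun i => nth 0%coq_nat (even_word i)), (fun i => size (even_word i)).
split; [exact: even_word_even | split].
- by move=> i n /leP h; exact: nth_default.
- move=> w m hw h; exists (pickle (mkseq w m)).
  have hw' n : leq (w n) 2 by apply/leP.
  rewrite even_word_pickle //; split; first exact: size_mkseq.
  by move=> r /ltP hr; rewrite nth_mkseq.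
Qed.

End Words.

(** * Coding by contractions *)

Definition shift {A : Type} (n : nat) (u : nat -> A) : nat -> A := fun i => u (n + i)%nat.

Lemma Rabs_le_inv x a : Rabs x <= a -> - a <= x <= a.
Proof. by move=> h; have := Rle_abs x; have := Rle_abs (- x); rewrite Rabs_Ropp; lra. Qed.

Lemma half_pow_small eps : 0 < eps -> exists n, (/ 2) ^ n < eps.
Proof.
move=> h; have [N hN] := pow_lt_1_zero (/ 2) ltac:(rewrite Rabs_pos_eq; lra) eps h.
by exists N; have := hN N (le_n _); rewrite Rabs_pos_eq //; apply: pow_le; lra.
Qed.

Lemma half_pow_le_eq x y : (forall n, Rabs (x - y) <= 2 * (/ 2) ^ n) -> x = y.
Proof.
move=> h; apply: NNPP => hne.
have hp : 0 < Rabs (x - y) by apply: Rabs_pos_lt; lra.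
have [n hn] := half_pow_small (Rabs (x - y) / 2) ltac:(lra).
have := h n; lra.
Qed.

Section Coding.
Variables (A : Type) (g : A -> R -> R).

(** One construction for three alphabets: inverse branches of [zig], binary digits, and numbers of
    [0,1] to be averaged. The common contraction rate 1/2 is the source of all bounds
    [(/ 2) ^ n]. *)
Fixpoint branch (u : nat -> A) (n : nat) (x : R) : R :=
  match n with O => x | S k => g (u O) (branch (shift 1 u) k x) end.

Definition codes (u : nat -> A) (x : R) : Prop :=
  I01 x /\ forall n z, I01 z -> Rabs (x - branch u n z) <= (/ 2) ^ n.

Definition code (u : nat -> A) : R := epsilon (inhabits 0) (codes u).

Hypothesis g01 : forall a x, I01 x -> I01 (g a x).
Hypothesis g_contr : forall a x y, Rabs (g a x - g a y) <= Rabs (x - y) / 2.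

Lemma branch_I01 u n x : I01 x -> I01 (branch u n x).
Proof. by elim: n u => [|n IH] u hx //=; apply: g01; apply: IH. Qed.

Lemma branch_contr u n x y : Rabs (branch u n x - branch u n y) <= (/ 2) ^ n * Rabs (x - y).
Proof.
elim: n u => [|n IH] u /=; first by lra.
have := g_contr (u O) (branch (shift 1 u) n x) (branch (shift 1 u) n y).
have := IH (shift 1 u); lra.
Qed.

Lemma branch_contr01 u n x y : I01 x -> I01 y -> Rabs (branch u n x - branch u n y) <= (/ 2) ^ n.
Proof.
move=> [hx1 hx2] [hy1 hy2]; have := branch_contr u n x y.
have : Rabs (x - y) <= 1 by apply: Rabs_le; lra.
have : 0 < (/ 2) ^ n by apply: pow_lt; lra.
nra.
Qed.

Lemma branch_add u n m x : branch u (n + m) x = branch u n (branch (shift n u) m x).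
Proof. by elim: n u => [|n IH] u //=; rewrite IH. Qed.

Lemma branch_agree u u' n x : (forall k, (k < n)%nat -> u k = u' k) -> branch u n x = branch u' n x.
Proof.
elim: n u u' => [|n IH] u u' h //=; rewrite (h O); last by lia.
congr (g _ _); apply: IH => k hk; apply: h; lia.
Qed.

Lemma codes_exists u : exists x, codes u x.
Proof.
have h0 : I01 0 by rewrite /I01; lra.
have hc : Cauchy_crit (fun n => branch u n 0).
  move=> eps heps; have [N hN] := half_pow_small (eps / 2) ltac:(lra).
  have key n : (n >= N)%nat -> Rabs (branch u n 0 - branch u N 0) < eps / 2.
    move=> hn; have -> : n = (N + (n - N))%nat by lia.
    rewrite branch_add; apply: Rle_lt_trans (branch_contr01 _ _ _ _ _ h0) _.
      exact: branch_I01.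
    exact: hN.
  exists N => n m hn hm; have := key n hn; have := key m hm.
  rewrite /Rdist => /Rabs_def2 h1 /Rabs_def2 h2; apply: Rabs_def1; lra.
have [l hl] := R_complete _ hc.
have bound n z : I01 z -> Rabs (l - branch u n z) <= (/ 2) ^ n.
  move=> hz; apply: Rnot_lt_le => hlt.
  have [N hN] := hl (Rabs (l - branch u n z) - (/ 2) ^ n) ltac:(lra).
  have := hN (n + N)%nat ltac:(lia); rewrite branch_add /Rdist => h1.
  have := branch_contr01 u n (branch (shift n u) N 0) z (branch_I01 _ _ _ h0) hz => h2.
  have := Rabs_triang (l - branch u n (branch (shift n u) N 0))
     (branch u n (branch (shift n u) N 0) - branch u n z).
  rewrite (Rabs_minus_sym l (branch u n (branch _ _ _))).
  have -> : l - branch u n (branch (shift n u) N 0) +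
    (branch u n (branch (shift n u) N 0) - branch u n z) = l - branch u n z by lra.
  lra.
exists l; split=> //.
split; apply: Rnot_lt_le => hlt.
- have [N hN] := hl (- l) ltac:(lra); have := hN N (le_n _); rewrite /Rdist.
  by have [??] := branch_I01 u N 0 h0; move=> /Rabs_def2; lra.
- have [N hN] := hl (l - 1) ltac:(lra); have := hN N (le_n _); rewrite /Rdist.
  by have [??] := branch_I01 u N 0 h0; move=> /Rabs_def2; lra.
Qed.

Lemma code_spec u : codes u (code u).
Proof. exact: epsilon_spec (codes_exists u). Qed.

Lemma code_I01 u : I01 (code u).
Proof. by have [] := code_spec u. Qed.

Lemma codes_unique u x y : codes u x -> codes u y -> x = y.
Proof.
move=> [_ hx] [_ hy]; apply: half_pow_le_eq => n.
have h0 : I01 0 by rewrite /I01; lra.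
have := hx n 0 h0; have := hy n 0 h0.
move=> /Rabs_le_inv ? /Rabs_le_inv ?; apply: Rabs_le; lra.
Qed.

Lemma code_step u : code u = g (u O) (code (shift 1 u)).
Proof.
apply: (codes_unique u); first exact: code_spec.
have [h1 h2] := code_spec (shift 1 u).
split; first exact: g01.
case=> [|n] z hz /=.
- have [??] := g01 (u O) _ h1; case: hz => ??; apply: Rabs_le; lra.
- have := g_contr (u O) (code (shift 1 u)) (branch (shift 1 u) n z); have := h2 n z hz; lra.
Qed.

Lemma code_branch u n : code u = branch u n (code (shift n u)).
Proof.
elim: n u => [|n IH] u //=; by rewrite code_step IH.
Qed.

Lemma code_agree u u' n : (forall k, (k < n)%nat -> u k = u' k) ->
  Rabs (code u - code u') <= (/ 2) ^ n.
Proof.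
move=> h; rewrite (code_branch u n) (code_branch u' n) (branch_agree _ _ _ _ h).
by apply: branch_contr01; apply: code_I01.
Qed.

Lemma code_onto (x : R) : (forall x, I01 x -> exists a z, I01 z /\ x = g a z) ->
  I01 x -> exists u, x = code u.
Proof.
move=> onto hx.
have hs : forall p : {x | I01 x}, exists q : A * {x | I01 x},
    proj1_sig p = g (fst q) (proj1_sig (snd q)).
  by move=> [y hy]; have [a [z [hz e]]] := onto y hy; exists (a, exist _ z hz).
pose step p := proj1_sig (constructive_indefinite_description _ (hs p)).
have stepE p : proj1_sig p = g (fst (step p)) (proj1_sig (snd (step p))).
  exact: proj2_sig (constructive_indefinite_description _ (hs p)).
(* Successive preimages of [x] under chosen maps [g a]; the chosen letters are the code. *)
pose orb := nat_rect (fun _ => {x | I01 x}) (exist _ x hx) (fun _ p => snd (step p)).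
pose u n := fst (step (orb n)).
exists u.
have key n k : proj1_sig (orb k) = branch (shift k u) n (proj1_sig (orb (k + n)%nat)).
  elim: n k => [|n IH] k /=; first by rewrite Nat.add_0_r.
  rewrite stepE; congr (g _ _); first by rewrite /shift Nat.add_0_r.
  have -> : snd (step (orb k)) = orb (S k) by [].
  rewrite IH -plus_n_Sm /=; congr branch.
  by apply: functional_extensionality => i; rewrite /shift; congr u; lia.
have hk n : x = branch u n (proj1_sig (orb n)).
  by have := key n O => /= ->; apply: branch_agree.
apply: half_pow_le_eq => n; rewrite (code_branch u n) {1}(hk n).
have := branch_contr01 u n (proj1_sig (orb n)) (code (shift n u)) (proj2_sig (orb n)) (code_I01 _).
have : 0 < (/ 2) ^ n by apply: pow_lt; lra.
lra.
Qed.

End Coding.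

Arguments branch {A}.
Arguments code {A}.

(** * The zigzag map and lexicographic order *)

Definition zig (x : R) : R := Rmax (Rmin (3 * x) (2 - 3 * x)) (3 * x - 2).

(** The inverse branches of [zig]; any symbol above 2 acts as 2. *)
Definition g3 (a : nat) (x : R) : R :=
  match a with O => x / 3 | 1%nat => (2 - x) / 3 | _ => (2 + x) / 3 end.

Definition pt (u : nat -> nat) : R := code g3 u.

Lemma g3_I01 a x : I01 x -> I01 (g3 a x).
Proof. rewrite /I01; case: a => [|[|a]] /=; lra. Qed.

Lemma g3_dist a x y : Rabs (g3 a x - g3 a y) = Rabs (x - y) / 3.
Proof. by case: a => [|[|a]] /=; rewrite /Rabs; repeat case: Rcase_abs => ?; lra. Qed.

Lemma g3_contr a x y : Rabs (g3 a x - g3 a y) <= Rabs (x - y) / 2.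
Proof. rewrite g3_dist; have := Rabs_pos (x - y); lra. Qed.

Lemma zig_cases x : (x <= / 3 /\ zig x = 3 * x) \/
  (/ 3 <= x <= 2 / 3 /\ zig x = 2 - 3 * x) \/ (2 / 3 <= x /\ zig x = 3 * x - 2).
Proof.
rewrite /zig; case: (Rle_lt_dec x (/ 3)) => h1; [|case: (Rle_lt_dec x (2 / 3)) => h2].
- left; rewrite Rmin_left ?Rmax_left; lra.
- right; left; rewrite Rmin_right ?Rmax_left; lra.
- right; right; rewrite Rmin_right ?Rmax_right; lra.
Qed.

Lemma zig_g3 a x : I01 x -> zig (g3 a x) = x.
Proof.
move=> [h1 h2]; have := zig_cases (g3 a x).
by case: a => [|[|a]] /= [[? ->]|[[? ->]|[? ->]]]; lra.
Qed.

Lemma zig_lip x y : Rabs (zig x - zig y) <= 3 * Rabs (x - y).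
Proof.
have := zig_cases x; have := zig_cases y.
by move=> [[? ->]|[[? ->]|[? ->]]] [[? ->]|[[? ->]|[? ->]]]; rewrite /Rabs;
  repeat case: Rcase_abs => ?; lra.
Qed.

Lemma zig_I01 x : I01 x -> I01 (zig x).
Proof. rewrite /I01; have := zig_cases x; move=> [[? ->]|[[? ->]|[? ->]]]; lra. Qed.

Lemma zig_cmap01 : cmap01 zig.
Proof.
split; last exact: zig_I01.
move=> x _ eps he; exists (eps / 3); split; first by lra.
by move=> y _ h; have := zig_lip y x; lra.
Qed.

Lemma pt_I01 u : I01 (pt u).
Proof. exact: code_I01 nat g3 g3_I01 g3_contr u. Qed.

Lemma pt_branch u n : pt u = branch g3 u n (pt (shift n u)).
Proof. exact: code_branch nat g3 g3_I01 g3_contr u n. Qed.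

Lemma pt_agree u u' n : (forall k, (k < n)%nat -> u k = u' k) ->
  Rabs (pt u - pt u') <= (/ 2) ^ n.
Proof. exact: code_agree nat g3 g3_I01 g3_contr u u' n. Qed.

Lemma iter_pt n u : iter n zig (pt u) = pt (shift n u).
Proof.
elim: n => [|n IH] //=; rewrite IH (pt_branch _ 1) /=.
rewrite zig_g3; last exact: pt_I01.
by congr pt; apply: functional_extensionality => i; rewrite /shift; congr u; lia.
Qed.

Lemma branch_g3_affine u n x y : branch g3 u n x - branch g3 u n y =
  (if odd_ones u n then -1 else 1) * (x - y) * (/ 3) ^ n.
Proof.
elim: n x y => [|n IH] x y; first by rewrite /=; lra.
have e z : branch g3 u (S n) z = branch g3 u n (g3 (u n) z).
  by rewrite -(Nat.add_1_r n) branch_add /= /shift Nat.add_0_r.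
rewrite !e IH /=.
by case: (odd_ones u n); case: (u n) => [|[|a]] /=; lra.
Qed.

(** Up to the place [p] both points share one affine branch of slope [3^-p] up to sign; then one
    continues in [0,1/3] and the other in [2/3,1], which bounds [r] below by the middle third. *)
Lemma pt_first_diff u u' p : (forall k, (k < p)%nat -> u k = u' k) -> u p = O -> u' p = 2%nat ->
  exists r, / 3 <= r /\ pt u' - pt u = (if odd_ones u p then -1 else 1) * r * (/ 3) ^ p.
Proof.
move=> h h0 h2; rewrite (pt_branch u p) (pt_branch u' p).
rewrite -(branch_agree _ g3 u u' p _ h) branch_g3_affine.
exists (pt (shift p u') - pt (shift p u)); split=> //.
rewrite (pt_branch (shift p u') 1) (pt_branch (shift p u) 1) /=.
have -> : shift p u' O = 2%nat by rewrite /shift Nat.add_0_r.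
have -> : shift p u O = O by rewrite /shift Nat.add_0_r.
have [? ?] := pt_I01 (shift 1 (shift p u)); have [? ?] := pt_I01 (shift 1 (shift p u')).
rewrite /=; lra.
Qed.

Lemma pt_first_diff_dist u u' p : (forall k, (k < p)%nat -> u k = u' k) ->
  u p = O -> u' p = 2%nat -> (/ 3) ^ (S p) <= Rabs (pt u - pt u').
Proof.
move=> h h0 h2; have [r [hr e]] := pt_first_diff u u' p h h0 h2.
have hp : 0 < (/ 3) ^ p by apply: pow_lt; lra.
have hrp : / 3 * (/ 3) ^ p <= r * (/ 3) ^ p by apply: Rmult_le_compat_r; lra.
rewrite Rabs_minus_sym e /=; case: (odd_ones u p); rewrite /Rabs; repeat case: Rcase_abs => ?; nra.
Qed.

Lemma ternary_expansion x : I01 x -> exists u, (forall n, (u n <= 2)%nat) /\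
  forall n, exists z, I01 z /\ x = branch g3 u n z.
Proof.
move=> hx.
have [|u ->] := code_onto _ g3 g3_I01 g3_contr x _ hx.
  move=> y [h1 h2]; case: (Rle_lt_dec y (/ 3)) => h3.
    by exists O, (3 * y); rewrite /I01 /=; lra.
  case: (Rle_lt_dec y (2 / 3)) => h4.
    by exists 1%nat, (2 - 3 * y); rewrite /I01 /=; lra.
  by exists 2%nat, (3 * y - 2); rewrite /I01 /=; lra.
exists (fun n => Nat.min (u n) 2); split=> [n|n]; first by lia.
exists (pt (shift n u)); split; first exact: pt_I01.
rewrite -/(pt u) (pt_branch u n).
elim: n u (pt _) => [|n IH] u' z //=; rewrite IH.
by case: (u' O) => [|[|[|a]]].
Qed.

Lemma word_density a b : 0 <= a -> a < b -> b <= 1 -> exists w n,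
  (forall n, (w n <= 2)%nat) /\ forall z, I01 z -> a < branch g3 w n z < b.
Proof.
move=> ha hab hb.
have [n hn] := half_pow_small ((b - a) / 2) ltac:(lra).
have [u [hu hx]] := ternary_expansion ((a + b) / 2) ltac:(rewrite /I01; lra).
exists u, (S n); split=> // z hz.
have [z' [hz' e]] := hx (S n).
have := branch_contr01 _ g3 g3_contr u (S n) z z' hz hz'; rewrite -e /= => /Rabs_le_inv.
have : 0 < (/ 2) ^ n by apply: pow_lt; lra.
lra.
Qed.

(** * Lexicographic order and binary expansions *)

Definition lex_lt (y y' : nat -> bool) : Prop :=
  exists k, agree k y y' /\ y k = false /\ y' k = true.

Lemma first_difference (y y' : nat -> bool) : y <> y' ->
  exists k, agree k y y' /\ y k <> y' k.
Proof.
move=> hne; apply: NNPP => hno; apply: hne; apply: functional_extensionality => k.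
elim: k {-2}k (le_n k) => [|n IH] k hk; apply: NNPP => hk'; apply: hno; exists k; split=> // j hj.
  by lia.
by apply: IH; lia.
Qed.

Lemma lex_total y y' : y <> y' -> lex_lt y y' \/ lex_lt y' y.
Proof.
move=> /first_difference [k [h hk]].
case E: (y k); case E': (y' k); try by move: hk; rewrite E E'.
- by right; exists k; split=> // j hj; rewrite h.
- by left; exists k.
Qed.

Definition g2 (b : bool) (x : R) : R := if b then (1 + x) / 2 else x / 2.

Definition val (y : nat -> bool) : R := code g2 y.

Lemma g2_I01 a x : I01 x -> I01 (g2 a x).
Proof. rewrite /I01; case: a => /=; lra. Qed.

Lemma g2_contr a x y : Rabs (g2 a x - g2 a y) <= Rabs (x - y) / 2.
Proof. by case: a => /=; rewrite /Rabs; repeat case: Rcase_abs => ?; lra. Qed.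

Lemma val_I01 y : I01 (val y).
Proof. exact: code_I01 bool g2 g2_I01 g2_contr y. Qed.

Lemma val_onto x : I01 x -> exists y, x = val y.
Proof.
apply: (code_onto _ g2 g2_I01 g2_contr) => z [h1 h2].
case: (Rle_lt_dec z (/ 2)) => h3.
- by exists false, (2 * z); rewrite /I01 /=; lra.
- by exists true, (2 * z - 1); rewrite /I01 /=; lra.
Qed.

Lemma branch_g2_mono y n x x' : x <= x' -> branch g2 y n x <= branch g2 y n x'.
Proof. by elim: n y => [|n IH] y h //=; have := IH (shift 1 y) h; case: (y O) => /=; lra. Qed.

(** Only a weak inequality, as 0111... and 1000... represent the same number. *)
Lemma val_lex y y' : lex_lt y y' -> val y <= val y'.
Proof.
move=> [k [h [h0 h1]]].
rewrite /val (code_branch bool g2 g2_I01 g2_contr y k) (code_branch bool g2 g2_I01 g2_contr y' k).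
rewrite (branch_agree _ g2 y y' k _ h); apply: branch_g2_mono.
rewrite (code_step _ g2 g2_I01 g2_contr (shift k y)) (code_step _ g2 g2_I01 g2_contr (shift k y')).
have -> : shift k y O = false by rewrite /shift Nat.add_0_r.
have -> : shift k y' O = true by rewrite /shift Nat.add_0_r.
rewrite /=.
have [? ?] := code_I01 _ g2 g2_I01 g2_contr (shift 1 (shift k y)).
have [? ?] := code_I01 _ g2 g2_I01 g2_contr (shift 1 (shift k y')).
lra.
Qed.

Lemma val_zero : val (fun _ => false) = 0.
Proof.
have h0 : I01 0 by rewrite /I01; lra.
have [y e] := val_onto 0 h0; have [h _] := val_I01 (fun _ => false).
apply: Rle_antisym => //; rewrite e.
case: (classic ((fun _ => false) = y)) => [<-|/lex_total [/val_lex //|[k [_ [_ //]]]]]; lra.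
Qed.

(** * Distribution functions *)

(** A monotone function that takes all values has no jump. This yields the continuity of the
    distribution functions and of the inverse homeomorphism. *)
Lemma mono_onto_cont (D : R -> Prop) (F : R -> R) :
  (forall x x', D x -> D x' -> x <= x' -> F x <= F x') ->
  (forall x, D x -> I01 (F x)) ->
  (forall r, I01 r -> exists x, D x /\ F x = r) ->
  forall x, D x -> forall eps, eps > 0 -> exists del, del > 0 /\
    forall y, D y -> Rabs (y - x) < del -> Rabs (F y - F x) < eps.
Proof.
move=> mono rng onto x hx eps heps; have [h0 h1] := rng x hx.
have [d1 [hd1 k1]] : exists d, d > 0 /\ forall y, D y -> y < x + d -> F y < F x + eps.
  case: (Rle_lt_dec (F x + eps / 2) 1) => h; last first.
    by exists 1; split=> [|y hy _]; [lra | have [_ ?] := rng y hy; lra].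
  have [z [hz e]] := onto (F x + eps / 2) ltac:(rewrite /I01; lra).
  exists (z - x); split=> [|y hy hyz].
  - by apply: Rnot_le_gt => hle; have := mono z x hz hx ltac:(lra); lra.
  - by have := mono y z hy hz ltac:(lra); lra.
have [d2 [hd2 k2]] : exists d, d > 0 /\ forall y, D y -> x - d < y -> F x - eps < F y.
  case: (Rle_lt_dec 0 (F x - eps / 2)) => h; last first.
    by exists 1; split=> [|y hy _]; [lra | have [? _] := rng y hy; lra].
  have [z [hz e]] := onto (F x - eps / 2) ltac:(rewrite /I01; lra).
  exists (x - z); split=> [|y hy hyz].
  - by apply: Rnot_le_gt => hle; have := mono x z hx hz ltac:(lra); lra.
  - by have := mono z y hz hy ltac:(lra); lra.
exists (Rmin d1 d2); split; first by apply: Rmin_pos.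
move=> y hy /Rabs_def2 [ha hb].
have := Rmin_l d1 d2; have := Rmin_r d1 d2 => m1 m2.
by apply: Rabs_def1; [have := k1 y hy ltac:(lra) | have := k2 y hy ltac:(lra)]; lra.
Qed.

Section Cdf.
Variable psi : (nat -> bool) -> R.
Hypothesis psi_I01 : forall y, I01 (psi y).
Hypothesis psi_lex : forall y y', lex_lt y y' -> psi y < psi y'.

(* [cdf] is the distribution function of the image of the coin-tossing measure under [psi]; since
   [psi] is increasing for the lexicographic order, it maps [psi y] to the number [val y] with
   binary digits [y]. *)
Definition cdf_set (x r : R) : Prop := r = 0 \/ exists y, psi y <= x /\ r = val y.

Definition cdf (x : R) : R := epsilon (inhabits 0) (is_lub (cdf_set x)).

Lemma cdf_lub x : is_lub (cdf_set x) (cdf x).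
Proof.
apply: epsilon_spec.
have [|| l hl] := completeness (cdf_set x); last by exists l.
- by exists 1 => r [->|[y [_ ->]]]; [lra | have [_ ?] := val_I01 y].
- by exists 0; left.
Qed.

Lemma cdf_I01 x : I01 (cdf x).
Proof.
have [hu hl] := cdf_lub x; split; first by apply: hu; left.
by apply: hl => r [->|[y [_ ->]]]; [lra | have [_ ?] := val_I01 y].
Qed.

Lemma cdf_mono x x' : x <= x' -> cdf x <= cdf x'.
Proof.
move=> h; have [_ hl] := cdf_lub x; have [hu _] := cdf_lub x'; apply: hl => r hr; apply: hu.
by case: hr => [->|[y [h1 ->]]]; [left | right; exists y; split=> //; lra].
Qed.

Lemma psi_le_val y y' : psi y <= psi y' -> val y <= val y'.
Proof.
move=> h; case: (classic (y = y')) => [->|/lex_total [/val_lex //|/psi_lex]]; lra.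
Qed.

Lemma cdf_psi y : cdf (psi y) = val y.
Proof.
have [hu hl] := cdf_lub (psi y); apply: Rle_antisym.
- apply: hl => r [->|[y' [h ->]]]; [by have [] := val_I01 y | exact: psi_le_val].
- by apply: hu; right; exists y; split=> //; lra.
Qed.

Lemma cdf_cont x eps : eps > 0 -> exists del, del > 0 /\
  forall y, Rabs (y - x) < del -> Rabs (cdf y - cdf x) < eps.
Proof.
move=> he.
have [|||del [h1 h2]] := mono_onto_cont (fun _ => True) cdf _ _ _ x I eps he.
- by move=> z z' _ _; exact: cdf_mono.
- by move=> z _; exact: cdf_I01.
- by move=> r /val_onto [y ->]; exists (psi y); split; last exact: cdf_psi.
- by exists del; split=> // y; exact: h2.
Qed.

Lemma cdf_gap a b : a <= b -> (forall y, ~ (a < psi y <= b)) -> cdf a = cdf b.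
Proof.
move=> hab hgap; apply: Rle_antisym; first exact: cdf_mono.
have [_ hl] := cdf_lub b; have [hu _] := cdf_lub a; apply: hl => r hr; apply: hu.
case: hr => [->|[y [h1 ->]]]; first by left.
by right; exists y; split=> //; apply: Rnot_lt_le => h; apply: (hgap y).
Qed.

(** The value [a] may be attained, but by the sequence 000... only, which contributes 0. *)
Lemma cdf_left a : (forall y, a <= psi y) -> cdf a = 0.
Proof.
move=> ha; have [hu hl] := cdf_lub a; apply: Rle_antisym; last by apply: hu; left.
apply: hl => r [->|[y [h1 ->]]]; first by lra.
rewrite -val_zero; apply: psi_le_val; have := ha (fun _ => false); lra.
Qed.

Lemma cdf_right b : (forall y, psi y <= b) -> cdf b = 1.
Proof.
move=> hb; apply: Rle_antisym; first by have [] := cdf_I01 b.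
have [y ->] := val_onto 1 ltac:(rewrite /I01; lra).
by rewrite -(cdf_psi y); apply: cdf_mono.
Qed.

Hypothesis psi_cont : forall n y y', agree n y y' -> Rabs (psi y - psi y') <= (/ 2) ^ n.

(** Compactness of the space of 0-1 sequences, by hand: bits are chosen one at a time so that [psi]
    still comes arbitrarily near [x] on the cylinder. *)
Lemma psi_range_closed x : (forall eps, eps > 0 -> exists y, Rabs (psi y - x) < eps) ->
  exists y, psi y = x.
Proof.
move=> hx.
pose P n z := forall eps, eps > 0 -> exists y, agree n y z /\ Rabs (psi y - x) < eps.
pose upd (z : nat -> bool) n b i := if Nat.eqb i n then b else z i.
pose next z n := if excluded_middle_informative (P (S n) (upd z n true)) then true else false.
have step n z : P n z -> P (S n) (upd z n (next z n)).
  rewrite /next; case: excluded_middle_informative => // hno hP eps he.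
  have [e0 [he0 hbad]] : exists e0, e0 > 0 /\
      forall y, agree (S n) y (upd z n true) -> ~ Rabs (psi y - x) < e0.
    apply: NNPP => hh; apply: hno => e1 he1; apply: NNPP => hk; apply: hh.
    by exists e1; split=> // y h1 h2; apply: hk; exists y.
  (* The cylinder with the bit [true] stays [e0] away from [x], so an approximation better than [e0]
     has the bit [false]. *)
  have [y [hy1 hy2]] := hP (Rmin eps e0) ltac:(by apply: Rmin_pos).
  exists y; have := Rmin_l eps e0; have := Rmin_r eps e0 => m1 m2; split; last by lra.
  have upd_agree b : y n = b -> agree (S n) y (upd z n b).
    move=> hb k hk; rewrite /upd; case: Nat.eqb_spec => [->//|hne]; apply: hy1; lia.
  by case E: (y n); [case: (hbad y (upd_agree _ E)); lra | exact: upd_agree].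
pose zs := nat_rect (fun _ => nat -> bool) (fun _ => false) (fun n z => upd z n (next z n)).
have hzs n : P n (zs n).
  elim: n => [|n IH] /=; last exact: step.
  by move=> eps /hx [y hy]; exists y; split=> // k hk; lia.
have later n k : zs (S n + k)%nat n = zs (S n) n.
  elim: k => [|k IH]; first by rewrite Nat.add_0_r.
  rewrite -plus_n_Sm -IH /= /upd; case: Nat.eqb_spec => //; lia.
exists (fun n => zs (S n) n); apply: half_pow_le_eq => n.
have [y [h1 h2]] := hzs n ((/ 2) ^ n) ltac:(apply: pow_lt; lra).
have h3 : Rabs (psi y - psi (fun n => zs (S n) n)) <= (/ 2) ^ n.
  apply: psi_cont => k hk; rewrite (h1 k hk) -(later k (n - S k)%nat).
  by congr (zs _ k); lia.
have := Rabs_triang (psi (fun n => zs (S n) n) - psi y) (psi y - x).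
rewrite (Rabs_minus_sym _ (psi y)).
have -> : psi (fun n => zs (S n) n) - psi y + (psi y - x) = psi (fun n => zs (S n) n) - x by lra.
lra.
Qed.

End Cdf.

(** * Null sets and covers *)

Fixpoint sumn (f : nat -> R) (n : nat) : R :=
  match n with O => 0 | S k => sumn f k + f k end.

Lemma sum_f_R0_sumn f n : sum_f_R0 f n = sumn f (S n).
Proof. elim: n => [|n IH] /=; first by lra. by rewrite IH. Qed.

Lemma sumn_le f g n : (forall k, (k < n)%nat -> f k <= g k) -> sumn f n <= sumn g n.
Proof.
elim: n => [|n IH] h /=; first by lra.
by have := IH ltac:(move=> k hk; apply: h; lia); have := h n ltac:(lia); lra.
Qed.

Lemma sumn_ext f g n : (forall k, (k < n)%nat -> f k = g k) -> sumn f n = sumn g n.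
Proof.
by move=> h; apply: Rle_antisym; apply: sumn_le => k hk; rewrite h //; lra.
Qed.

Lemma sumn_plus f g n : sumn (fun k => f k + g k) n = sumn f n + sumn g n.
Proof. by elim: n => [|n IH] /=; rewrite ?IH; lra. Qed.

Lemma sumn_cat f n m : sumn f (n + m) = sumn f n + sumn (fun k => f (n + k)%nat) m.
Proof.
elim: m => [|m IH] /=; first by rewrite Nat.add_0_r; lra.
by rewrite -plus_n_Sm /= IH; lra.
Qed.

Lemma sumn_double f n : sumn f (2 * n) = sumn (fun k => f (2 * k)%nat + f (2 * k + 1)%nat) n.
Proof.
elim: n => [|n IH] //; have -> : (2 * S n = S (S (2 * n)))%nat by lia.
by cbn [sumn]; rewrite IH (Nat.add_1_r (2 * n)); lra.
Qed.

Lemma sumn_incr f n m : (forall k, 0 <= f k) -> (n <= m)%nat -> sumn f n <= sumn f m.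
Proof. by move=> h; elim=> [|k _ IH] /=; [lra | have := h k; lra]. Qed.

Lemma sumn_ge_term f n m : (forall k, 0 <= f k) -> (m < n)%nat -> f m <= sumn f n.
Proof.
move=> h hm; have := sumn_incr f (S m) n h hm; have := sumn_incr f 0 m h ltac:(lia).
by rewrite /=; lra.
Qed.

Lemma sumn_telescope (F : nat -> R) n : sumn (fun k => F (S k) - F k) n = F n - F O.
Proof. by elim: n => [|n IH] /=; rewrite ?IH; lra. Qed.

Definition interleave {A : Type} (a b : nat -> A) (n : nat) : A :=
  if Nat.even n then a (Nat.div2 n) else b (Nat.div2 n).

Lemma interleave_even {A : Type} (a b : nat -> A) n : interleave a b (2 * n) = a n.
Proof. by rewrite /interleave Nat.even_even Nat.div2_double. Qed.

Lemma interleave_odd {A : Type} (a b : nat -> A) n : interleave a b (2 * n + 1) = b n.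
Proof. by rewrite /interleave Nat.even_odd Nat.add_1_r Nat.div2_succ_double. Qed.

Lemma sumn_interleave f a b c n : (forall k, 0 <= f k) ->
  (forall k, f (2 * k)%nat = a k) -> (forall k, f (2 * k + 1)%nat = b k) ->
  (forall k, sumn a k + sumn b k <= c) -> sumn f n <= c.
Proof.
move=> h0 ha hb hc; apply: Rle_trans (sumn_incr f n (2 * n) h0 ltac:(lia)) _.
rewrite sumn_double (sumn_ext _ (fun k => a k + b k)) ?sumn_plus // => k _.
by rewrite ha hb.
Qed.

(* Real induction on [x]: the part of the cover lying in [0,x] has total length at least [x]. *)
Lemma cover_total_length a b c : (forall n, a n <= b n) ->
  (forall x, I01 x -> exists n : nat, a n <= x <= b n) ->
  (forall n, sumn (fun k => b k - a k) n <= c) -> 1 <= c.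
Proof.
move=> hab hcov hsum; apply: Rnot_lt_le => hc.
(* The enlargements below add less than [4 * d = (1 - c) / 2], which keeps the total under 1. *)
pose d := (1 - c) / 8.
have hp n : 0 < (/ 2) ^ n by apply: pow_lt; lra.
pose a' n := a n - d * (/ 2) ^ n; pose b' n := b n + d * (/ 2) ^ n.
have hd : 0 < d by rewrite /d; lra.
have hdp n : 0 < d * (/ 2) ^ n by apply: Rmult_lt_0_compat.
have hsum' n : sumn (fun k => b' k - a' k) n < 1.
  have -> : sumn (fun k => b' k - a' k) n = sumn (fun k => b k - a k) n + 4 * d * (1 - (/ 2) ^ n).
    by elim: n => [|n IH] /=; rewrite ?IH /a' /b'; lra.
  have := hsum n; have := hdp n; rewrite /d; lra.
pose l x n := Rmax 0 (Rmin (b' n) x - Rmax (a' n) 0).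
have l_pos x n : 0 <= l x n by exact: Rmax_l.
have l_mono x z n : x <= z -> l x n <= l z n.
  move=> h; rewrite /l; apply: Rle_max_compat_l.
  by have := Rle_min_compat_l _ _ (b' n) h; lra.
pose X x := I01 x /\ exists N, x <= sumn (l x) N.
have X0 : X 0 by split; [rewrite /I01; lra | exists O; rewrite /=; lra].
have notX1 : ~ X 1.
  move=> [_ [N hN]]; have := hsum' N; suff : sumn (l 1) N <= sumn (fun k => b' k - a' k) N by lra.
  apply: sumn_le => k _; rewrite /l; apply: Rmax_lub.
    by have := hab k; have := hdp k; rewrite /a' /b'; lra.
  by have := Rmin_l (b' k) 1; have := Rmax_l (a' k) 0; lra.
have [||s [hu hl]] := completeness X; [by exists 1 => x [[_ ?] _] | by exists 0 |].
have s0 : 0 <= s by apply: hu.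
have s1 : s <= 1 by apply: hl => x [[_ ?] _].
have [m [hm1 hm2]] := hcov s ltac:(by []).
have ham : a' m < s by have := hdp m; rewrite /a'; lra.
have hbm : s < b' m by have := hdp m; rewrite /b'; lra.
have [x [[hxI [N hN]] hx]] : exists x, X x /\ a' m < x.
  apply: NNPP => hno; have : s <= a' m; last by lra.
  by apply: hl => x hx; apply: Rnot_lt_le => h; apply: hno; exists x.
have hxs : x <= s by apply: hu; split=> //; exists N.
(* A point of the enlarged interval beyond [s], cut off at 1. Membership in [X] will give [z <= s],
   which forces [z = 1]. *)
pose z := Rmin 1 ((s + b' m) / 2).
have hz1 : z <= 1 by exact: Rmin_l.
have hz2 : z <= (s + b' m) / 2 by exact: Rmin_r.
have hsz : s <= z by apply: Rmin_glb; lra.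
have Xz : X z.
  split; first by rewrite /I01; lra.
  exists (Nat.max N (S m)).
  have h1 := sumn_incr (l x) N (Nat.max N (S m)) (l_pos x) ltac:(lia).
  have h2 : l z m - l x m = z - x.
    have [hx0 _] := hxI.
    rewrite /l (Rmin_right (b' m) z) ?(Rmin_right (b' m) x); try lra.
    have ? : Rmax (a' m) 0 <= x by apply: Rmax_lub; lra.
    by rewrite (Rmax_right 0 (z - _)) ?(Rmax_right 0 (x - _)); lra.
  have h3 := sumn_ge_term (fun k => l z k - l x k) (Nat.max N (S m)) m
    ltac:(by move=> k; have := l_mono x z k ltac:(lra); lra) ltac:(lia).
  have h4 : sumn (l z) (Nat.max N (S m)) =
      sumn (l x) (Nat.max N (S m)) + sumn (fun k => l z k - l x k) (Nat.max N (S m)).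
    by rewrite -sumn_plus; apply: sumn_ext => k _; lra.
  by rewrite /= in h3; lra.
have hzs : z <= s by apply: hu.
have z1 : z = 1.
  move: hzs; rewrite /z /Rmin; case: Rle_dec => //; lra.
by apply: notX1; rewrite -z1.
Qed.

(** * Covers by maximal dyadic cells *)

Section DyadicCover.
Variables (h G : R -> R) (good : R -> R -> Prop) (E : R -> Prop).
Hypothesis good_sub : forall a b a' b', a <= a' -> a' <= b' -> b' <= b -> good a b -> good a' b'.
Hypothesis h_mono : forall x y, 0 <= x -> x <= y -> y <= 1 -> h x <= h y.
Hypothesis G_mono : forall x y, 0 <= x -> x <= y -> y <= 1 -> G x <= G y.
Hypothesis good_incr : forall a b, 0 <= a -> a <= b -> b <= 1 -> good a b -> h b - h a <= G b - G a.
Hypothesis good_near : forall x, E x -> I01 x /\ exists eps, eps > 0 /\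
  forall a b, a <= x <= b -> b - a < eps -> good a b.

Definition lo (k j : nat) : R := INR j * (/ 2) ^ k.

Definition cell_good (k j : nat) : bool :=
  if excluded_middle_informative (good (lo k j) (lo k (S j))) then true else false.

Lemma cell_goodP k j : cell_good k j = true <-> good (lo k j) (lo k (S j)).
Proof. by rewrite /cell_good; case: excluded_middle_informative. Qed.

(* The maximal good dyadic cells: they do not overlap. *)
Definition selected (k j : nat) : bool :=
  cell_good k j && (if k is S k' then ~~ cell_good k' (Nat.div2 j) else true).

Lemma lo_left k j : lo (S k) (2 * j) = lo k j.
Proof. by rewrite /lo mult_INR -tech_pow_Rmult (_ : INR 2 = 2) //; field. Qed.

Lemma lo_right k j : lo (S k) (S (2 * j + 1)) = lo k (S j).
Proof. by rewrite -(lo_left k (S j)); congr lo; lia. Qed.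

Lemma lo_le k i j : (i <= j)%nat -> lo k i <= lo k j.
Proof.
by move=> hij; apply: Rmult_le_compat_r; [apply: pow_le; lra | apply: le_INR].
Qed.

Lemma lo_top k : lo k (2 ^ k) = 1.
Proof.
rewrite /lo pow_INR -Rpow_mult_distr /=.
by have -> : (1 + 1) * / 2 = 1; [lra | rewrite pow1].
Qed.

Lemma lo_0 k : lo k 0 = 0.
Proof. by rewrite /lo /=; lra. Qed.

Lemma lo_I01 k j : (j <= 2 ^ k)%nat -> I01 (lo k j).
Proof.
move=> hj; rewrite /I01 -{1}(lo_0 k) -(lo_top k); split; apply: lo_le => //; lia.
Qed.

Definition incr (k j : nat) : R := G (lo k (S j)) - G (lo k j).

Lemma incr_pos k j : (j < 2 ^ k)%nat -> 0 <= incr k j.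
Proof.
move=> hj; have [? ?] := lo_I01 k j ltac:(lia); have [? ?] := lo_I01 k (S j) ltac:(lia).
have hle := lo_le k j (S j) ltac:(lia).
by have := G_mono (lo k j) (lo k (S j)) ltac:(lra) hle ltac:(lra); rewrite /incr; lra.
Qed.

(** The halves of a good cell are good and have the same total increment; the remaining good cells
    of level [k+1] are the newly selected ones. Thus the selected increments up to a level add up to
    those of its good cells. *)
Lemma selected_level k :
  sumn (fun j => if cell_good (S k) j then incr (S k) j else 0) (2 ^ S k) =
  sumn (fun j => if cell_good k j then incr k j else 0) (2 ^ k) +
  sumn (fun j => if selected (S k) j then incr (S k) j else 0) (2 ^ S k).
Proof.
rewrite Nat.pow_succ_r' !sumn_double -sumn_plus; apply: sumn_ext => j hj.
rewrite /selected (Nat.add_1_r (2 * j)) Nat.div2_double Nat.div2_succ_double.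
case Eg: (cell_good k j); rewrite ?andbF ?andbT; last by lra.
have sub i : (i = 2 * j)%nat \/ (i = S (2 * j))%nat -> cell_good (S k) i = true.
  move=> hi; apply/cell_goodP; apply: good_sub (proj1 (cell_goodP k j) Eg).
  - by rewrite -(lo_left k j); apply: lo_le; lia.
  - by apply: lo_le; lia.
  - by rewrite -(lo_right k j); apply: lo_le; lia.
rewrite !sub; [|by right|by left].
rewrite /incr lo_left -(lo_right k j) (Nat.add_1_r (2 * j)); lra.
Qed.

(** All cells in one sequence: the index [n] stands for cell [j] of level [k], where
    [n + 1 = 2^k + j]. *)
Definition level (n : nat) : nat := Nat.log2 (S n).
Definition offset (n : nat) : nat := (S n - 2 ^ level n)%nat.

Lemma level_offset k j : (j < 2 ^ k)%nat ->
  level (2 ^ k - 1 + j) = k /\ offset (2 ^ k - 1 + j) = j.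
Proof.
move=> hj; have hk : (0 < 2 ^ k)%nat by have := Nat.pow_nonzero 2 k ltac:(lia); lia.
have hl : level (2 ^ k - 1 + j) = k.
  by apply: Nat.log2_unique; [lia | rewrite Nat.pow_succ_r'; lia].
by split=> //; rewrite /offset hl; lia.
Qed.

Lemma offset_lt n : (offset n < 2 ^ level n)%nat.
Proof.
by have := Nat.log2_spec (S n) ltac:(lia); rewrite /offset /level Nat.pow_succ_r'; lia.
Qed.

Definition weight (n : nat) : R :=
  if selected (level n) (offset n) then incr (level n) (offset n) else 0.

Lemma weight_pos n : 0 <= weight n.
Proof. by rewrite /weight; case: selected; [exact/incr_pos/offset_lt | lra]. Qed.

Lemma weight_total k : sumn weight (2 ^ S k - 1) =
  sumn (fun j => if cell_good k j then incr k j else 0) (2 ^ k).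
Proof.
have hk i : (0 < 2 ^ i)%nat by have := Nat.pow_nonzero 2 i ltac:(lia); lia.
have block i : sumn weight (2 ^ S i - 1) = sumn weight (2 ^ i - 1) +
    sumn (fun j => if selected i j then incr i j else 0) (2 ^ i).
  have -> : (2 ^ S i - 1 = 2 ^ i - 1 + 2 ^ i)%nat by have := hk i; rewrite Nat.pow_succ_r'; lia.
  rewrite sumn_cat; congr (_ + _); apply: sumn_ext => j hj.
  by rewrite /weight; have [-> ->] := level_offset i j hj.
elim: k => [|k IH].
- by rewrite block /= /selected andbT; lra.
- by rewrite block IH selected_level.
Qed.

Lemma weight_bound n : sumn weight n <= G 1 - G 0.
Proof.
have hn : (n <= 2 ^ S n - 1)%nat.
  by have := Nat.pow_gt_lin_r 2 (S n) ltac:(lia); lia.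
apply: Rle_trans (sumn_incr weight _ _ weight_pos hn) _; rewrite weight_total.
rewrite -(lo_top n) -{2}(lo_0 n) -(sumn_telescope (fun j => G (lo n j))).
apply: sumn_le => j hj; rewrite -/(incr n j); case: cell_good; first by lra.
exact: incr_pos.
Qed.

Lemma cell_near x k : I01 x -> exists j, (j < 2 ^ k)%nat /\ lo k j <= x <= lo k (S j).
Proof.
move=> [h0 h1]; elim: k => [|k [j [hj hx]]].
  by exists O; rewrite /lo /=; split; [lia | lra].
case: (Rle_lt_dec x (lo (S k) (S (2 * j)))) => hle.
- exists (2 * j)%nat; split; first by rewrite Nat.pow_succ_r'; lia.
  by rewrite lo_left; lra.
- exists (2 * j + 1)%nat; split; first by rewrite Nat.pow_succ_r'; lia.
  by rewrite lo_right Nat.add_1_r; lra.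
Qed.

(** Moving from a good cell to its parent as long as the parent is good ends at a selected cell. *)
Lemma cell_selected k j x : (j < 2 ^ k)%nat -> cell_good k j = true ->
  lo k j <= x <= lo k (S j) -> exists k' j', (j' < 2 ^ k')%nat /\
  selected k' j' = true /\ lo k' j' <= x <= lo k' (S j').
Proof.
elim: k j => [|k IH] j hj hg hx; first by exists O, j; rewrite /selected hg.
case Ep: (cell_good k (Nat.div2 j)); last first.
  by exists (S k), j; rewrite /selected hg Ep.
apply: IH Ep _.
- by rewrite Nat.pow_succ_r' in hj; have := Nat.div2_odd j; case: Nat.odd => /=; lia.
- have hodd := Nat.div2_odd j; rewrite -(lo_left k (Nat.div2 j)) -(lo_right k (Nat.div2 j)); split.
    by apply: Rle_trans (proj1 hx); apply: lo_le; lia.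
  by apply: Rle_trans (proj2 hx) _; apply: lo_le; case: Nat.odd hodd => /=; lia.
Qed.

(** The images of the selected cells form the cover. Increments of [G] bound their lengths and, the
    cells not overlapping, add up to at most [G 1 - G 0]. *)
Lemma dyadic_cover : exists a b : nat -> R, (forall n, a n <= b n) /\
  (forall x, E x -> exists n, a n <= h x <= b n) /\
  forall n, sumn (fun k => b k - a k) n <= G 1 - G 0.
Proof.
pose sel n := selected (level n) (offset n).
(* Cells that are not selected give a degenerate interval at 0. *)
pose a n := if sel n then h (lo (level n) (offset n)) else 0.
pose b n := if sel n then h (lo (level n) (S (offset n))) else 0.
have cell n : 0 <= lo (level n) (offset n) /\ lo (level n) (S (offset n)) <= 1 /\
    lo (level n) (offset n) <= lo (level n) (S (offset n)).
  have := offset_lt n => ho; have [? ?] := lo_I01 (level n) (offset n) ltac:(lia).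
  have [? ?] := lo_I01 (level n) (S (offset n)) ltac:(lia).
  by split=> //; split=> //; apply: lo_le; lia.
exists a, b; split; [|split].
- move=> n; have [? [? ?]] := cell n; rewrite /a /b; case: (sel n); last by lra.
  exact: h_mono.
- move=> x /good_near [hx [eps [he hgood]]].
  have [k hk] := half_pow_small eps he.
  have [j [hj hxj]] := cell_near x k hx.
  have hg : cell_good k j = true.
    by apply/cell_goodP; apply: hgood => //; rewrite /lo S_INR; lra.
  have [k' [j' [hj' [hs hx']]]] := cell_selected k j x hj hg hxj.
  have [hl ho] := level_offset k' j' hj'.
  exists (2 ^ k' - 1 + j')%nat; rewrite /a /b /sel hl ho hs.
  have [? ?] := lo_I01 k' j' ltac:(lia); have [? ?] := lo_I01 k' (S j') ltac:(lia).
  by case: hx => ? ?; split; apply: h_mono; lra.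
- move=> n; apply: Rle_trans (weight_bound n); apply: sumn_le => k _.
  rewrite /a /b /weight -/(sel k); case Es: (sel k); last by lra.
  have [? [? ?]] := cell k; apply: good_incr => //.
  by move: Es; rewrite /sel /selected; case Eg: cell_good => // _; apply/cell_goodP.
Qed.

End DyadicCover.

(** * The homeomorphism *)

(** The letters are the numbers of [0,1] themselves, as a subtype, since the coding requires each
    map to preserve [0,1]. *)
Definition avg (r : {r | I01 r}) (z : R) : R := (proj1_sig r + z) / 2.

Lemma avg_I01 r z : I01 z -> I01 (avg r z).
Proof. by case: r => r [h1 h2]; rewrite /avg /I01 /=; lra. Qed.

Lemma avg_contr r x y : Rabs (avg r x - avg r y) <= Rabs (x - y) / 2.
Proof. by rewrite /avg /Rabs; repeat case: Rcase_abs => ?; lra. Qed.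

(* [mean u] is the sum of the [u i / 2^(i+1)]. *)
Definition mean (u : nat -> {r | I01 r}) : R := code avg u.

Lemma mean_I01 u : I01 (mean u).
Proof. exact: code_I01 _ avg avg_I01 avg_contr u. Qed.

Lemma mean_branch u n : mean u = branch avg u n (mean (shift n u)).
Proof. exact: code_branch _ avg avg_I01 avg_contr u n. Qed.

Lemma branch_avg_close u u' n z z' eps :
  (forall i, (i < n)%nat -> proj1_sig (u' i) <= proj1_sig (u i) + eps) ->
  0 <= eps -> z' <= z + 1 -> branch avg u' n z' <= branch avg u n z + eps + (/ 2) ^ n.
Proof.
elim: n u u' => [|n IH] u u' h he hz /=; first by lra.
have := IH (shift 1 u) (shift 1 u') ltac:(move=> i hi; apply: h; lia) he hz.
by have := h O ltac:(lia); rewrite /avg; lra.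
Qed.

Lemma branch_avg_lt u u' n z z' : (forall i, proj1_sig (u i) <= proj1_sig (u' i)) ->
  z < z' -> branch avg u n z < branch avg u' n z'.
Proof.
elim: n u u' => [|n IH] u u' h hz //=.
have := IH (shift 1 u) (shift 1 u') ltac:(move=> i; apply: h) hz; have := h O; rewrite /avg; lra.
Qed.

Lemma mean_close u u' n eps :
  (forall i, (i < n)%nat -> proj1_sig (u' i) <= proj1_sig (u i) + eps) ->
  0 <= eps -> mean u' <= mean u + eps + (/ 2) ^ n.
Proof.
move=> h he; rewrite (mean_branch u n) (mean_branch u' n); apply: branch_avg_close => //.
by have [? ?] := mean_I01 (shift n u); have [? ?] := mean_I01 (shift n u'); lra.
Qed.

Lemma mean_le u u' : (forall i, proj1_sig (u i) <= proj1_sig (u' i)) -> mean u <= mean u'.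
Proof.
move=> h; apply: Rnot_lt_le => hlt.
have [n hn] := half_pow_small (mean u - mean u') ltac:(lra).
have := mean_close u' u n 0 ltac:(move=> i _; have := h i; lra) ltac:(lra); lra.
Qed.

Lemma mean_lt u u' k : (forall i, proj1_sig (u i) <= proj1_sig (u' i)) ->
  proj1_sig (u k) < proj1_sig (u' k) -> mean u < mean u'.
Proof.
move=> h hk; rewrite (mean_branch u k) (mean_branch u' k); apply: branch_avg_lt => //.
rewrite (mean_branch (shift k u) 1) (mean_branch (shift k u') 1) /= /avg.
have h0 w : shift k w O = w k :> {r | I01 r} by rewrite /shift Nat.add_0_r.
rewrite !h0.
have := mean_le (shift 1 (shift k u)) (shift 1 (shift k u')) ltac:(move=> i; apply: h); lra.
Qed.

Lemma branch_avg_diff u n z z' : branch avg u n z' - branch avg u n z = (/ 2) ^ n * (z' - z).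
Proof.
elim: n u => [|n IH] u /=; first by lra.
by have := IH (shift 1 u); rewrite /avg; lra.
Qed.

Lemma branch_avg_ext u u' n z : (forall i, (i < n)%nat -> proj1_sig (u i) = proj1_sig (u' i)) ->
  branch avg u n z = branch avg u' n z.
Proof.
elim: n u u' => [|n IH] u u' h //=.
by rewrite (IH (shift 1 u) (shift 1 u')) /avg ?(h O) //; [lia | move=> i hi; apply: h; lia].
Qed.

(** * The mixture of the distribution functions *)

Section MeasureHomeo.
Variable psi : nat -> (nat -> bool) -> R.
Hypothesis psi_I01 : forall i y, I01 (psi i y).
Hypothesis psi_lex : forall i y y', lex_lt y y' -> psi i y < psi i y'.
Hypothesis psi_cont : forall i n y y', agree n y y' -> Rabs (psi i y - psi i y') <= (/ 2) ^ n.
Hypothesis psi_dense : forall a b, 0 <= a -> a < b -> b <= 1 ->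
  exists i, forall y, a <= psi i y <= b.

Definition cdfs (x : R) (i : nat) : {r | I01 r} := exist _ (cdf (psi i) x) (cdf_I01 (psi i) x).

Definition hom (x : R) : R := mean (cdfs x).

Lemma hom_I01 x : I01 (hom x).
Proof. exact: mean_I01. Qed.

Lemma tail_mono n x x' : x <= x' -> mean (shift n (cdfs x)) <= mean (shift n (cdfs x')).
Proof. by move=> h; apply: mean_le => i /=; apply: cdf_mono. Qed.

(** Some Cantor set lies between [x] and [x']: its distribution function rises from 0 to 1 there,
    and no other one decreases. *)
Lemma hom_lt x x' : 0 <= x -> x < x' -> x' <= 1 -> hom x < hom x'.
Proof.
move=> h0 h h1; have [i hi] := psi_dense x x' h0 h h1.
apply: (mean_lt _ _ i) => [j|] /=; first by apply: cdf_mono; lra.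
rewrite (cdf_left _ (psi_lex i)) ?(cdf_right _ (psi_lex i)); first by lra.
- by move=> y; have := hi y; lra.
- by move=> y; have := hi y; lra.
Qed.

Lemma hom_le x x' : 0 <= x -> x <= x' -> x' <= 1 -> hom x <= hom x'.
Proof. by move=> _ h _; apply: mean_le => i /=; apply: cdf_mono. Qed.

Lemma hom_cont x eps : eps > 0 -> exists del, del > 0 /\
  forall y, Rabs (y - x) < del -> Rabs (hom y - hom x) < eps.
Proof.
move=> he; have [n hn] := half_pow_small (eps / 2) ltac:(lra).
have [d [hd h]] : exists d, d > 0 /\ forall i, (i < n)%nat -> forall y, Rabs (y - x) < d ->
    Rabs (cdf (psi i) y - cdf (psi i) x) < eps / 2.
  elim: (n) => [|m [d [hd IH]]]; first by exists 1; split; [lra | lia].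
  have [d' [hd' h]] := cdf_cont (psi m) (psi_lex m) x (eps / 2) ltac:(lra).
  exists (Rmin d d'); split; first by apply: Rmin_pos.
  move=> i hi y hy; have := Rmin_l d d'; have := Rmin_r d d' => ? ?.
  have [->|hne] := Nat.eq_dec i m; first by apply: h; lra.
  by apply: IH; [lia | lra].
exists d; split=> // y hy.
have h1 : hom y <= hom x + eps / 2 + (/ 2) ^ n.
  by apply: mean_close; [move=> i hi /=; have /Rabs_def2 := h i hi y hy; lra | lra].
have h2 : hom x <= hom y + eps / 2 + (/ 2) ^ n.
  by apply: mean_close; [move=> i hi /=; have /Rabs_def2 := h i hi y hy; lra | lra].
by apply: Rabs_def1; lra.
Qed.

Lemma hom_0 : hom 0 = 0.
Proof.
apply: Rle_antisym; last by have [] := hom_I01 0.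
apply: Rnot_lt_le => hlt; have [n hn] := half_pow_small (hom 0) hlt.
have hz i : cdf (psi i) 0 = 0.
  by apply: (cdf_left _ (psi_lex i)) => y; have [] := psi_I01 i y.
have h00 : I01 0 by rewrite /I01; lra.
pose z : nat -> {r | I01 r} := fun _ => exist I01 0 h00.
have : hom 0 <= branch avg z n 0 + 0 + (/ 2) ^ n.
  rewrite /hom (mean_branch _ n); apply: branch_avg_close; try lra.
  - by move=> i _ /=; rewrite hz; lra.
  - by have [? ?] := mean_I01 (shift n (cdfs 0)); lra.
suff -> : branch avg z n 0 = 0 by lra.
by elim: (n) => [|m IH] //=; rewrite /avg IH /=; lra.
Qed.

Lemma hom_1 : hom 1 = 1.
Proof.
apply: Rle_antisym; first by have [] := hom_I01 1.
apply: Rnot_lt_le => hlt; have [n hn] := half_pow_small (1 - hom 1) ltac:(lra).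
have hz i : cdf (psi i) 1 = 1.
  by apply: (cdf_right _ (psi_lex i)) => y; have [] := psi_I01 i y.
have h11 : I01 1 by rewrite /I01; lra.
pose z : nat -> {r | I01 r} := fun _ => exist I01 1 h11.
have : branch avg z n 1 <= hom 1 + 0 + (/ 2) ^ n.
  rewrite /hom (mean_branch (cdfs 1) n); apply: branch_avg_close; try lra.
  - by move=> i _ /=; rewrite hz; lra.
  - by have [? ?] := mean_I01 (shift n (cdfs 1)); lra.
suff -> : branch avg z n 1 = 1 by lra.
by elim: (n) => [|m IH] //=; rewrite /avg IH /=; lra.
Qed.

Lemma hom_onto z : I01 z -> exists x, I01 x /\ hom x = z.
Proof.
move=> [h0 h1].
have cont : continuity (fun x => hom x - z).
  move=> x eps he; have [del [hd h]] := hom_cont x eps he.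
  exists del; split=> // y [_ hy]; have := h y hy; rewrite /= /Rdist.
  by have -> : hom y - z - (hom x - z) = hom y - hom x by lra.
have [|x [hx e]] := IVT_cor _ 0 1 cont ltac:(lra); first by rewrite hom_0 hom_1; nra.
by exists x; split=> //; lra.
Qed.

Definition hom_inv (z : R) : R := epsilon (inhabits 0) (fun x => I01 x /\ hom x = z).

Lemma hom_invP z : I01 z -> I01 (hom_inv z) /\ hom (hom_inv z) = z.
Proof. by move=> /hom_onto h; exact: epsilon_spec h. Qed.

Lemma hom_invK x : I01 x -> hom_inv (hom x) = x.
Proof.
move=> [h0 h1]; have [[h2 h3] e] := hom_invP _ (hom_I01 x).
case: (Rtotal_order (hom_inv (hom x)) x) => [h|[//|h]].
- by have := hom_lt _ _ h2 h h1; lra.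
- by have := hom_lt _ _ h0 h h3; lra.
Qed.

Lemma hom_inv_cont : cont01 hom_inv.
Proof.
apply: mono_onto_cont.
- move=> z z' hz hz' hle; apply: Rnot_lt_le => h.
  have [[? ?] e] := hom_invP _ hz; have [[? ?] e'] := hom_invP _ hz'.
  by have := hom_lt (hom_inv z') (hom_inv z) ltac:(lra) h ltac:(lra); lra.
- by move=> z /hom_invP [].
- by move=> x hx; exists (hom x); split; [exact: hom_I01 | exact: hom_invK].
Qed.

(** Good intervals are those that miss the first [N] Cantor sets; these sets being closed, a missed
    point has only good intervals near it. On them [hom] grows exactly as [G], the tail of the
    mixture, whose total growth is at most 2^-N. *)
Lemma missed_cover N : exists a b : nat -> R, (forall n, a n <= b n) /\
  (forall x, I01 x -> (forall i y, (i < N)%nat -> psi i y <> x) ->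
     exists n, a n <= hom x <= b n) /\
  forall n, sumn (fun k => b k - a k) n <= (/ 2) ^ N.
Proof.
have hp : 0 < (/ 2) ^ N by apply: pow_lt; lra.
pose G x := (/ 2) ^ N * mean (shift N (cdfs x)).
pose good a b := forall i y, (i < N)%nat -> ~ (a <= psi i y <= b).
have [||||| a [b [h1 [h2 h3]]]] := dyadic_cover hom G good
  (fun x => I01 x /\ forall i y, (i < N)%nat -> psi i y <> x).
- by move=> a b a' b' ? ? ? hg i y hi ?; apply: (hg i y hi); lra.
- exact: hom_le.
- by move=> x y _ h _; apply: Rmult_le_compat_l; [lra | exact: tail_mono].
- move=> a b h0 hab hb1 hg; apply: Req_le.
  rewrite /hom (mean_branch _ N) (mean_branch (cdfs a) N) /G.
  rewrite (branch_avg_ext (cdfs b) (cdfs a)) ?branch_avg_diff; first by lra.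
  move=> i hi /=; symmetry; apply: cdf_gap => // y hy; apply: (hg i y hi); lra.
- move=> x [hx hmiss]; split=> //.
  have [e [he h]] : exists e, e > 0 /\ forall i y, (i < N)%nat -> e <= Rabs (psi i y - x).
    elim: N {hp G good} hmiss => [|m IH] hmiss; first by exists 1; split; [lra | lia].
    have [e [he h]] := IH ltac:(by move=> i y hi; apply: hmiss; lia).
    have [e' [he' h']] : exists e, e > 0 /\ forall y, e <= Rabs (psi m y - x).
      apply: NNPP => hno.
      have [|y hy] := psi_range_closed (psi m) (psi_cont m) x.
        move=> eps heps; apply: NNPP => hn; apply: hno; exists eps; split=> // y.
        by apply: Rnot_lt_le => hlt; apply: hn; exists y.
      by apply: (hmiss m y ltac:(lia)).
    exists (Rmin e e'); split; first by apply: Rmin_pos.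
    move=> i y hi; have := Rmin_l e e'; have := Rmin_r e e' => ? ?.
    have [->|hne] := Nat.eq_dec i m; first by have := h' y; lra.
    by have := h i y ltac:(lia); lra.
  exists e; split=> // a b hab hlt i y hi hy.
  by have := h i y hi; have : Rabs (psi i y - x) < e by [apply: Rabs_def1; lra]; lra.
- exists a, b; split=> //; split=> [x hx hm|n]; first by apply: h2.
  have := h3 n; rewrite /G.
  have [? _] := mean_I01 (shift N (cdfs 0)); have [_ ?] := mean_I01 (shift N (cdfs 1)); nra.
Qed.

Lemma hom_full : full_measure01 (fun z => I01 z /\ exists i y, psi i y = hom_inv z).
Proof.
split=> [z [] //|eps he].
have [N hN] := half_pow_small eps he.
have [a [b [h1 [h2 h3]]]] := missed_cover N.
exists a, b; split=> //; split=> [z [hz hno]|n].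
- have [hx e] := hom_invP z hz; rewrite -e; apply: h2 => // i y _ hy.
  by apply: hno; split=> //; exists i, y.
- by rewrite sum_f_R0_sumn; have := h3 (S n); lra.
Qed.

(** A cover of the image of the first Cantor set of length 1/4, joined to the cover of the other
    points of length 1/2, would cover [0,1] with total length 3/4. *)
Lemma hom_positive : ~ null1 (fun z => I01 z /\ exists y, psi 0 y = hom_inv z).
Proof.
move=> /(_ (/ 4) ltac:(lra)) [a [b [h1 [h2 h3]]]].
have [a' [b' [h1' [h2' h3']]]] := missed_cover 1.
have hle n : interleave a a' n <= interleave b b' n.
  by rewrite /interleave; case: Nat.even.
have := cover_total_length (interleave a a') (interleave b b') (3 / 4) hle; move=> hcov.
suff : 1 <= 3 / 4 by lra.
apply: hcov => [z hz|n].
- have [hx e] := hom_invP z hz.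
  case: (classic (exists y, psi 0 y = hom_inv z)) => hy.
  + by have [n hn] := h2 z (conj hz hy); exists (2 * n)%nat; rewrite !interleave_even.
  + have [|n hn] := h2' (hom_inv z) hx.
      move=> i y hi; have -> : i = O by lia.
      by move=> hy'; apply: hy; exists y.
    by exists (2 * n + 1)%nat; rewrite !interleave_odd -e.
- apply: (sumn_interleave _ (fun k => b k - a k) (fun k => b' k - a' k)) => k.
  + by have := hle k; lra.
  + by rewrite !interleave_even.
  + by rewrite !interleave_odd.
  + have := h3' k; have : sumn (fun k => b k - a k) k <= / 4; last by rewrite /=; lra.
    by case: k => [|k]; [rewrite /=; lra | rewrite -sum_f_R0_sumn].
Qed.

Lemma measure_homeo : exists h hinv : R -> R, cmap01 h /\ cmap01 hinv /\
  (forall x, I01 x -> hinv (h x) = x) /\ (forall z, I01 z -> h (hinv z) = z) /\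
  full_measure01 (fun z => I01 z /\ exists i y, psi i y = hinv z) /\
  ~ null1 (fun z => I01 z /\ exists y, psi 0 y = hinv z).
Proof.
exists hom, hom_inv; split; [|split; [|split; [|split; [|split]]]].
- split=> [x _ eps he|x _]; last exact: hom_I01.
  by have [d [hd h]] := hom_cont x eps he; exists d; split=> // y _; exact: h.
- by split; [exact: hom_inv_cont | move=> z /hom_invP []].
- exact: hom_invK.
- by move=> z /hom_invP [].
- exact: hom_full.
- exact: hom_positive.
Qed.

End MeasureHomeo.

(** * Dynamics of the coded points *)

Lemma eventually_forall_lt d (P : nat -> nat -> Prop) :
  (forall j, (j < d)%nat -> exists K0, forall K, (K0 <= K)%nat -> P j K) ->
  exists K0, forall K, (K0 <= K)%nat -> forall j, (j < d)%nat -> P j K.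
Proof.
elim: d => [|d IH] h; first by exists O; lia.
have [K1 h1] := IH ltac:(by move=> j hj; apply: h; lia).
have [K2 h2] := h d ltac:(lia).
exists (Nat.max K1 K2) => K hK j hj.
have [->|hne] := Nat.eq_dec j d; first by apply: h2; lia.
by apply: h1; lia.
Qed.

Lemma odd_ones_xor u w m n : (m <= n)%nat -> (forall k, (m <= k < n)%nat -> u k = w k) ->
  odd_ones u m = odd_ones w m -> odd_ones u n = odd_ones w n.
Proof.
elim: n / => // n hn IH h e /=; rewrite h; last by lia.
by rewrite IH // => k hk; apply: h; lia.
Qed.

Lemma zig_iter_I01 n x : I01 x -> I01 (iter n zig x).
Proof. by elim: n => [|n IH] //= hx; apply: zig_I01; apply: IH. Qed.

Lemma zig_iter_lip n x y : Rabs (iter n zig x - iter n zig y) <= 3 ^ n * Rabs (x - y).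
Proof.
elim: n => [|n IH] /=; first by lra.
by have := zig_lip (iter n zig x) (iter n zig y); lra.
Qed.

Lemma iter_add (f : R -> R) n m x : iter (n + m) f x = iter n f (iter m f x).
Proof. by elim: n => //= n ->. Qed.

Lemma zig_iter_branch u n x : I01 x -> iter n zig (branch g3 u n x) = x.
Proof.
elim: n u => [|n IH] u hx //.
rewrite -(Nat.add_1_r n) iter_add Nat.add_comm branch_add /= zig_g3; first exact: IH.
by apply: branch_I01 => //; exact: g3_I01.
Qed.

Lemma third_pow_le m n : (m <= n)%nat -> (/ 3) ^ n <= (/ 3) ^ m.
Proof.
elim: n / => [|n _ IH] /=; first by lra.
by have : 0 < (/ 3) ^ n by [apply: pow_lt; lra]; lra.
Qed.

Lemma pt_near u u' m eps : (/ 2) ^ m < eps -> (forall k, (k < m)%nat -> u k = u' k) ->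
  Rabs (pt u - pt u') < eps.
Proof. by move=> h /pt_agree; lra. Qed.

Lemma family_mono v l k k' : symbol_family v l -> (k <= k')%nat -> (l k <= l k')%nat.
Proof. move=> H; elim: k' / => // k' _ IH; have := sf_incr _ _ H k'; lia. Qed.

Lemma family_ge v l k : symbol_family v l -> (k <= l k)%nat.
Proof. move=> H; elim: k => [|k IH]; first lia; have := sf_incr _ _ H k; lia. Qed.

(** Limits see the orbit from some time on only, so a point behind an arbitrary initial word is as
    good as [pt (v c)]. *)
Definition tracks (v : (nat -> bool) -> nat -> nat) (x : R) (c : nat -> bool) : Prop :=
  exists M, forall n, (M <= n)%nat -> iter n zig x = pt (shift n (v c)).

Lemma tracks_pt v c : tracks v (pt (v c)) c.
Proof. by exists O => n _; exact: iter_pt. Qed.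

(** * Scrambled tuples from the block property *)

Section Scrambled.
Variables (v : (nat -> bool) -> nat -> nat) (l : nat -> nat).
Hypothesis Hv : symbol_family v l.
Hypothesis Hblock : block_prop v.

Variables (d : nat) (x : nat -> R) (c : nat -> nat -> bool).
Hypothesis x_tracks : forall j, (j < d)%nat -> tracks v (x j) (c j).

Lemma tracks_eventually : exists M, forall n, (M <= n)%nat -> forall j, (j < d)%nat ->
  iter n zig (x j) = pt (shift n (v (c j))).
Proof. exact: eventually_forall_lt x_tracks. Qed.

Lemma scrambled_proximal : proximal zig d x.
Proof.
move=> eps he N; have [M hM] := tracks_eventually.
have [m hm] := half_pow_small eps he.
(* A constant map: at time [o] all points show the first [m] symbols of [v (c 0)]. *)
have [o [ho h]] := Hblock (N + M + m)%nat (fun _ => c O) ltac:(by []).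
exists o; split; first by lia.
move=> i j hi hj; rewrite !hM //; try lia.
apply: (pt_near _ _ m) => // k hk; rewrite /shift !h //; lia.
Qed.

Hypothesis c_distinct : forall i j, (i < d)%nat -> (j < d)%nat -> i <> j -> c i <> c j.

(* Distinct labels are sent by [phi] to the sequences with a single 1, at places below [d]:
   the resulting separation depends on [d] only. *)
Lemma scrambled_separated : forall N, exists n, (n >= N)%nat /\
  forall i j, (i < d)%nat -> (j < d)%nat -> i <> j ->
  (/ 3) ^ S (l d) <= Rabs (iter n zig (x i) - iter n zig (x j)).
Proof.
move=> N; have [M hM] := tracks_eventually.
have [K1 hK1] : exists K0, forall K, (K0 <= K)%nat -> forall i, (i < d)%nat ->
    forall j, (j < d)%nat -> i <> j -> ~ agree K (c i) (c j).
  apply: eventually_forall_lt => i hi.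
  apply: (eventually_forall_lt d (fun j K => i <> j -> ~ agree K (c i) (c j))) => j hj.
  have [->|hne] := Nat.eq_dec i j; first by exists O.
  have [k [_ hk]] := first_difference _ _ (c_distinct i j hi hj hne).
  by exists (S k) => K hK _ hag; apply: hk; apply: hag.
(* From [K1] bits on the labels are told apart; [S (l d)] makes the window reach the place [l i] of
   each bit [i < d]. *)
pose K := (N + M + K1 + S (l d))%nat.
pose phi (y : nat -> bool) k :=
  if excluded_middle_informative ((k < d)%nat /\ agree K y (c k)) then true else false.
have phiE j k : (j < d)%nat -> phi (c j) k = Nat.eqb k j.
  move=> hj; rewrite /phi; case: excluded_middle_informative => [[hk hag]|hno].
  - case: Nat.eqb_spec => // hne; exfalso.
    by apply: (hK1 K _ j hj k hk _ hag); [rewrite /K; lia | move=> e; apply: hne].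
  - by case: Nat.eqb_spec => // e; exfalso; apply: hno; rewrite e; split.
have [y y' hyy|o [ho h]] := Hblock K phi.
  move=> k _; rewrite /phi.
  case: excluded_middle_informative => [[hk hag]|hno];
  case: excluded_middle_informative => [[hk' hag']|hno'] //; exfalso.
  - by apply: hno'; split=> // a ha; rewrite -hyy // hag.
  - by apply: hno; split=> // a ha; rewrite hyy // hag'.
(* The labels with a single 1, at [i] and at [j], first differ at the smaller place [i], which shows
   at [l i]. *)
have main i j : (i < d)%nat -> (j < d)%nat -> (i < j)%nat ->
    (/ 3) ^ S (l d) <= Rabs (iter o zig (x i) - iter o zig (x j)).
  move=> hi hj hij; have hl := family_mono _ _ i d Hv ltac:(lia).
  rewrite !hM; try (rewrite /K in ho; lia).
  apply: Rle_trans (third_pow_le (S (l i)) (S (l d)) ltac:(lia)) _.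
  rewrite Rabs_minus_sym; apply: pt_first_diff_dist.
  - move=> k hk; rewrite /shift !h; try (rewrite /K; lia).
    apply: (sf_agree _ _ Hv i) => // a ha; rewrite !phiE //.
    by case: Nat.eqb_spec => [?|_]; [lia|case: Nat.eqb_spec => [?|_] //; lia].
  - rewrite /shift h; last by rewrite /K; lia.
    by rewrite (sf_bit _ _ Hv) phiE //; case: Nat.eqb_spec => // ?; lia.
  - rewrite /shift h; last by rewrite /K; lia.
    by rewrite (sf_bit _ _ Hv) phiE // Nat.eqb_refl.
exists o; split; first by rewrite /K in ho; lia.
move=> i j hi hj hne; have [hlt|hlt] : (i < j \/ j < i)%nat by lia.
- exact: main.
- by rewrite Rabs_minus_sym; apply: main.
Qed.

End Scrambled.

Lemma equal_labels_not_separated v x y c delta : 0 < delta ->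
  tracks v x c -> tracks v y c -> ~ separated zig 2 (pair2 x y) delta.
Proof.
move=> hd [M hM] [M' hM'] [eta [he /(_ (M + M')%nat)]].
move=> [n [hn /(_ O 1%nat ltac:(lia) ltac:(lia) ltac:(lia))]] /=.
by rewrite hM ?hM' ?Rminus_diag ?Rabs_R0; lra || lia.
Qed.

(** * Pairs that are not proximal *)

Section Distal.
Variables (v : (nat -> bool) -> nat -> nat) (l : nat -> nat).
Hypothesis Hv : symbol_family v l.
Hypothesis v_ne1 : forall y n, v y n <> 1%nat.
Hypothesis v_distal : forall y y' k, y k <> y' k -> exists R, forall n, exists j, (j <= R)%nat /\
  v y (n + j)%nat <> v y' (n + j)%nat.

(** Every window of length [r + 1] contains a difference of the codes, and the first one is 0
    against 2; so the distance stays at least [3^-(r+1)] once both points follow their codes. *)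
Lemma distal_not_proximal x y c c' : tracks v x c -> tracks v y c' -> c <> c' ->
  ~ proximal zig 2 (pair2 x y).
Proof.
move=> [M hM] [M' hM'] /first_difference [k [_ hk]] hprox.
have [r hr] := v_distal _ _ _ hk.
have hp : 0 < (/ 3) ^ S r by apply: pow_lt; lra.
have [n [hn /(_ O 1%nat ltac:(lia) ltac:(lia)) /=]] := hprox _ hp (M + M')%nat.
rewrite hM ?hM'; try lia; apply: Rle_not_lt.
have [j [hj hne]] := hr n.
have [j' [hj' [hag hne']]] : exists j', (j' <= r)%nat /\
    (forall i, (i < j')%nat -> v c (n + i)%nat = v c' (n + i)%nat) /\
    v c (n + j')%nat <> v c' (n + j')%nat.
  elim: j {-2}j (le_n j) hj hne => [|m IH] j hjm hj hne; first by exists j; repeat split=> //; lia.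
  case: (classic (forall i, (i < j)%nat -> v c (n + i)%nat = v c' (n + i)%nat)) => h.
    by exists j.
  have [i hi] := not_all_ex_not _ _ h; have [h1 h2] := imply_to_and _ _ hi.
  by apply: (IH i); [lia | lia |].
apply: Rle_trans (third_pow_le (S j') (S r) ltac:(lia)) _.
have ? := v_ne1 c (n + j'); have ? := v_ne1 c' (n + j').
have ? := sf_le2 _ _ Hv c (n + j'); have ? := sf_le2 _ _ Hv c' (n + j').
have [[e e']|[e e']] : (v c (n + j') = O /\ v c' (n + j') = 2 \/
  v c (n + j') = 2 /\ v c' (n + j') = O)%nat by lia.
- exact: pt_first_diff_dist.
- by rewrite Rabs_minus_sym; apply: pt_first_diff_dist => // i hi; rewrite /shift hag.
Qed.

End Distal.

Lemma omega_I01 f x y : (forall n, I01 (iter n f x)) -> omega_limit f x y -> I01 y.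
Proof.
move=> hI hy; split; apply: Rnot_lt_le => h.
- have [n [_ /Rabs_def2 hn]] := hy (- y) ltac:(lra) O; have [? ?] := hI n; lra.
- have [n [_ /Rabs_def2 hn]] := hy (y - 1) ltac:(lra) O; have [? ?] := hI n; lra.
Qed.

(** * Dense orbits *)

Section Transitive.
Variables (v : (nat -> bool) -> nat -> nat).
Hypothesis v_words : forall w : nat -> nat, (forall n, (w n <= 2)%nat) -> forall N m,
  exists o, (N <= o)%nat /\ forall y r, (r < m)%nat -> v y (o + r)%nat = w r.

Lemma transitive_omega x c z : I01 x -> tracks v x c -> omega_limit zig x z <-> I01 z.
Proof.
move=> hx [M hM]; split=> [|hz].
  by apply: omega_I01 => n; exact: zig_iter_I01.
move=> eps he N; have [w [hw hwz]] := ternary_expansion z hz.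
have [m hm] := half_pow_small eps he.
have [o [ho h]] := v_words w hw (N + M)%nat m.
exists o; split; first by lia.
rewrite hM; last by lia.
have [t [ht ->]] := hwz m; rewrite (pt_branch _ m) (branch_agree _ _ (shift o (v c)) w).
  by have := branch_contr01 _ g3 g3_contr w m _ t (pt_I01 (shift m (shift o (v c)))) ht; lra.
by move=> k hk; rewrite /shift h.
Qed.

End Transitive.

(** * The minimal set *)

Section Minimal.
Variables (v : (nat -> bool) -> nat -> nat) (l : nat -> nat).
Hypothesis Hv : symbol_family v l.
Hypothesis Hblock : block_prop v.
Hypothesis v_ne1 : forall y n, v y n <> 1%nat.
Hypothesis v_recurrent : forall K, exists R, forall y y' n, exists j, (j <= R)%nat /\
  forall r, (r < K)%nat -> v y (n + j + r)%nat = v y' r.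

Definition min_set (x : R) : Prop := omega_limit zig (pt (v (fun _ => false))) x.

Lemma min_set_I01 x : min_set x -> I01 x.
Proof. by apply: omega_I01 => n; apply: zig_iter_I01; exact: pt_I01. Qed.

(** What [x] shows at time [n] belongs to an initial word of [v c], and this word recurs in [v c']
    after any given time. *)
Lemma omega_sub x y c c' z : tracks v x c -> tracks v y c' ->
  omega_limit zig x z -> omega_limit zig y z.
Proof.
move=> [M hM] [M' hM'] hz eps he N.
have [n [hn h]] := hz (eps / 2) ltac:(lra) M.
have [m hm] := half_pow_small (eps / 2) ltac:(lra).
have [r hr] := v_recurrent (n + m)%nat.
have [j [hj hj']] := hr c' c (N + M')%nat.
exists (N + M' + j + n)%nat; split; first by lia.
rewrite hM'; last by lia.
rewrite hM in h; last by lia.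
have : Rabs (pt (shift (N + M' + j + n) (v c')) - pt (shift n (v c))) < eps / 2.
  apply: (pt_near _ _ m) => // k hk; rewrite /shift -Nat.add_assoc hj' //; lia.
by move=> /Rabs_def2 ?; move: h => /Rabs_def2 ?; apply: Rabs_def1; lra.
Qed.

Lemma omega_tracks x c z : tracks v x c -> omega_limit zig x z <-> min_set z.
Proof.
move=> hx; have h0 := tracks_pt v (fun _ => false).
split; [exact: omega_sub hx h0 | exact: omega_sub h0 hx].
Qed.

Lemma pt_min_set c : min_set (pt (v c)).
Proof.
apply/(omega_tracks _ _ _ (tracks_pt v c)) => eps he N.
have [m hm] := half_pow_small eps he; have [r hr] := v_recurrent m.
have [j [hj h]] := hr c c N.
exists (N + j)%nat; split; first by lia.
by rewrite iter_pt; apply: (pt_near _ _ m) => // k hk; exact: h.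
Qed.

Lemma min_set_closed : Defs.closed_set min_set.
Proof.
move=> y hy eps he N; have [a [ha h]] := hy (eps / 2) ltac:(lra).
have [n [hn h']] := ha (eps / 2) ltac:(lra) N; exists n; split=> //.
by move: h h' => /Rabs_def2 ? /Rabs_def2 ?; apply: Rabs_def1; lra.
Qed.

Lemma min_set_invariant : invariant zig min_set.
Proof.
move=> x hx eps he N; have [n [hn h]] := hx (eps / 3) ltac:(lra) N.
exists (S n); split; first by lia.
by rewrite /=; have := zig_lip (iter n zig (pt (v (fun _ => false)))) x; lra.
Qed.

Lemma min_set_iter n x : min_set x -> min_set (iter n zig x).
Proof. by elim: n => //= n IH hx; apply: min_set_invariant; apply: IH. Qed.

(** A point [b] of the subset follows a piece of the orbit of [q] for [r + n] steps; within [r]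
    steps that orbit repeats its initial word of length [n + m], and [n] steps later it is near
    [x]. *)
Lemma min_set_minimal : minimal_set zig min_set.
Proof.
split; [|split; [exact: min_set_closed | split; [exact: min_set_invariant|]]].
  by exists (pt (v (fun _ => false))); exact: pt_min_set.
move=> B [b hb] hclosed hinv hsub x hx; apply: hclosed => eps he.
set q := pt (v (fun _ => false)) in hx.
have [n [_ h1]] := hx (eps / 3) ltac:(lra) O.
have [m hm] := half_pow_small (eps / 3) ltac:(lra).
have [r hr] := v_recurrent (n + m)%nat.
have hp k : 0 < 3 ^ k by apply: pow_lt; lra.
(* A distance that [r + n] steps of Lipschitz constant 3 enlarge to at most [eps / 3]. *)
have hq : eps / 3 / 3 ^ (r + n) > 0 by apply: Rdiv_lt_0_compat; [lra | exact: hp].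
have [n1 [_ h2]] := hsub b hb _ hq O.
have [j [hj h3]] := hr (fun _ => false) (fun _ => false) n1.
exists (iter (j + n) zig b); split.
  by elim: (j + n)%nat => //= k IH; apply: hinv.
have h4 : Rabs (iter (j + n) zig b - iter (j + n) zig (iter n1 zig q)) <= eps / 3.
  apply: Rle_trans (zig_iter_lip _ _ _) _; rewrite Rabs_minus_sym.
  apply: (Rle_trans _ (3 ^ (j + n) * (eps / 3 / 3 ^ (r + n)))).
    by apply: Rmult_le_compat_l; [have := hp (j + n)%nat; lra | rewrite /q; lra].
  have hle : 3 ^ (j + n) <= 3 ^ (r + n) by apply: Rle_pow; [lra | lia].
  apply: (Rle_trans _ (3 ^ (r + n) * (eps / 3 / 3 ^ (r + n)))).
    apply: Rmult_le_compat_r => //; apply: Rlt_le; apply: Rdiv_lt_0_compat; [lra | exact: hp].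
  by apply: Req_le; field; have := hp (r + n)%nat; lra.
have h5 : Rabs (iter (j + n) zig (iter n1 zig q) - iter n zig q) < eps / 3.
  rewrite -iter_add /q !iter_pt; apply: (pt_near _ _ m) => // k hk; rewrite /shift.
  by rewrite -(h3 (n + k)%nat); [congr (v _ _); lia | lia].
rewrite -/q in h1; move: h1 h5 => /Rabs_def2 ? /Rabs_def2 ?; move: h4 => /Rabs_le_inv ?.
by apply: Rabs_def1; lra.
Qed.

Lemma min_set_gap z : / 3 < z < 2 / 3 -> ~ min_set z.
Proof.
move=> hz hA.
have [n [_ h]] := hA (Rmin (z - / 3) (2 / 3 - z)) ltac:(apply: Rmin_pos; lra) O.
move: h; rewrite iter_pt (pt_branch _ 1) /= => h.
have [? ?] := pt_I01 (shift 1 (shift n (v (fun _ => false)))).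
have m1 := Rmin_l (z - / 3) (2 / 3 - z); have m2 := Rmin_r (z - / 3) (2 / 3 - z).
move: h; set s := shift n _ O; have hs : s <> 1%nat by exact: v_ne1.
case: s hs => [|[|a]] //= _ /Rabs_def2; lra.
Qed.

Lemma min_set_cantor : cantor_set min_set.
Proof.
split; [|split; [exact: min_set_I01 | split; [exact: min_set_closed | split]]].
- by exists (pt (v (fun _ => false))); exact: pt_min_set.
- move=> x hx eps he.
  have [n [_ h]] := hx (eps / 2) ltac:(lra) O.
  (* If the orbit point near [x] is [x] itself, another one comes from a label that differs at a
     single far bit [k], so far that [n] steps keep the points close. *)
  case: (classic (iter n zig (pt (v (fun _ => false))) = x)) => hne; last first.
    exists (iter n zig (pt (v (fun _ => false)))); split; [|split=> //; lra].
    exact/min_set_iter/pt_min_set.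
  have hp : 0 < 3 ^ n by apply: pow_lt; lra.
  have [k hk] := half_pow_small (eps / 3 ^ n) ltac:(exact: Rdiv_lt_0_compat).
  pose c := fun i => Nat.eqb i k.
  exists (iter n zig (pt (v c))); split; first exact/min_set_iter/pt_min_set.
  have hc : c <> (fun _ => false) by move=> /(congr1 (fun f => f k)); rewrite /c Nat.eqb_refl.
  split.
  + move=> hx'.
    (* Coincidence at time [n] would persist, against the separation at a later time [m]. *)
    have [||m [hm /(_ O 1%nat ltac:(lia) ltac:(lia) ltac:(lia))]] :=
      scrambled_separated v l Hv Hblock 2 (pair2 (pt (v c)) (pt (v (fun _ => false))))
        (fun i => if i is O then c else fun _ => false) _ _ n.
    * by case=> [|j] _; exact: tracks_pt.
    * case=> [|[|i]] [|[|j]] hi hj hij //; try lia; move=> e; exact: hc (esym e).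
    * have hp' : 0 < (/ 3) ^ S (l 2) by apply: pow_lt; lra.
      have -> : m = (m - n + n)%nat by lia.
      rewrite [pair2 _ _ 0]/(pt (v c)) [pair2 _ _ 1]/(pt (v (fun _ => false))).
      rewrite !iter_add hx' hne Rminus_diag Rabs_R0; lra.
  + rewrite -hne; apply: Rle_lt_trans (zig_iter_lip _ _ _) _.
    have : Rabs (pt (v c) - pt (v (fun _ => false))) < eps / 3 ^ n.
      apply: (pt_near _ _ k) => // r hr; apply: (sf_agree _ _ Hv k).
        by move=> i hi; rewrite /c; case: Nat.eqb_spec => //; lia.
      by have := family_ge _ _ k Hv; lia.
    move=> h'; apply: (Rlt_le_trans _ (3 ^ n * (eps / 3 ^ n))).
      exact: Rmult_lt_compat_l.
    by apply: Req_le; field; lra.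
- move=> a b hab.
  case: (Rle_lt_dec b 0) => hb; [|case: (Rle_lt_dec 1 a) => ha].
  + by exists ((a + b) / 2); split; [lra | move=> /min_set_I01 [? ?]; lra].
  + by exists ((a + b) / 2); split; [lra | move=> /min_set_I01 [? ?]; lra].
  (* A whole branch image lies in the interval; its point over 1/2 returns after [n] steps to 1/2,
     in the gap. *)
  + have [w [n [_ hw]]] := word_density (Rmax a 0) (Rmin b 1) (Rmax_r _ _)
      ltac:(by apply: Rmax_lub_lt; apply: Rmin_glb_lt; lra) (Rmin_r _ _).
    have h2 : I01 (/ 2) by rewrite /I01; lra.
    have := hw _ h2 => -[hz1 hz2].
    exists (branch g3 w n (/ 2)); split.
      by have := Rmax_l a 0; have := Rmin_l b 1; lra.
    move=> /(min_set_iter n); rewrite zig_iter_branch //; apply: min_set_gap; lra.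
Qed.

End Minimal.

(** * The Cantor sets of coded points *)

Section Points.
Variables (v : (nat -> bool) -> nat -> nat) (l : nat -> nat).
Hypothesis Hv : symbol_family v l.
Variables (p : nat -> nat -> nat) (sz : nat -> nat).
Hypothesis p_even : forall i, odd_ones (p i) (sz i) = false.
Hypothesis p_zero : forall i n, (sz i <= n)%nat -> p i n = O.
Hypothesis p_all : forall w m, (forall n, (w n <= 2)%nat) -> odd_ones w m = false ->
  exists i, sz i = m /\ forall r, (r < m)%nat -> p i r = w r.

(** The successor leaves at least one zero after the [i] ones, to mark their end; the summand [sz]
    makes room for the word, as [l k >= k]. *)
Definition fixed_bits (i : nat) : nat := S (i + sz (Nat.pred i)).

(* The label 1^i 0...0 y, where the zeros put the first bit of [y] beyond the word [p (i-1)]. *)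
Definition label (i : nat) (y : nat -> bool) (n : nat) : bool :=
  if (n <? i)%nat then true
  else if (n <? fixed_bits i)%nat then false else y (n - fixed_bits i)%nat.

Definition prefix_length (i : nat) : nat := if i is O then O else l (fixed_bits i).

(* The word indexed by [0] is empty, so that the points [point 0 y] lie in the minimal set. *)
Definition point_code (i : nat) (y : nat -> bool) (n : nat) : nat :=
  if (n <? prefix_length i)%nat then p (Nat.pred i) n else v (label i y) n.

Definition point (i : nat) (y : nat -> bool) : R := pt (point_code i y).

(** The first zero is at the place [i]. Joint injectivity is what lets points of different Cantor
    sets be treated as points of one. *)
Lemma label_inj i i' y y' : label i y = label i' y' -> i = i' /\ y = y'.
Proof.
move=> e.
have bit j z : label j z j = false.
  rewrite /label Nat.ltb_irrefl; case: Nat.ltb_spec => //; rewrite /fixed_bits; lia.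
have low j z k : (k < j)%nat -> label j z k = true.
  by move=> h; rewrite /label; case: Nat.ltb_spec => //; lia.
have ei : i = i'.
  have [h|[//|h]] : (i < i' \/ i = i' \/ i' < i)%nat by lia.
  - by have := bit i y; rewrite e low.
  - by have := bit i' y'; rewrite -e low.
split=> //; subst i'; apply: functional_extensionality => n.
have : label i y (fixed_bits i + n)%nat = label i y' (fixed_bits i + n)%nat by rewrite e.
rewrite /label; case: Nat.ltb_spec => h; first by rewrite /fixed_bits in h; lia.
case: Nat.ltb_spec => h'; first by lia.
by rewrite Nat.add_comm Nat.add_sub.
Qed.

Lemma label_agree i k y y' : agree k y y' -> agree (fixed_bits i + k) (label i y) (label i y').
Proof.
move=> h n hn; rewrite /label; case: Nat.ltb_spec => // h1; case: Nat.ltb_spec => // h2.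
by apply: h; lia.
Qed.

Lemma label_bit i k y : label i y (fixed_bits i + k) = y k.
Proof.
rewrite /label; case: Nat.ltb_spec => h; first by rewrite /fixed_bits in h; lia.
case: Nat.ltb_spec => h'; first by lia.
by rewrite Nat.add_comm Nat.add_sub.
Qed.

Lemma prefix_le i k : (prefix_length i <= l (fixed_bits i + k))%nat.
Proof.
rewrite /prefix_length; case: i => [|i]; first by lia.
by apply: (family_mono _ _ _ _ Hv); lia.
Qed.

Lemma code_agree_below i k y y' : agree k y y' ->
  forall n, (n < l (fixed_bits i + k))%nat -> point_code i y n = point_code i y' n.
Proof.
move=> h n hn; rewrite /point_code; case: Nat.ltb_spec => // _.
by apply: (sf_agree _ _ Hv _ _ _ (label_agree i k y y' h)).
Qed.

Lemma code_bit i k y : point_code i y (l (fixed_bits i + k)) = if y k then 2%nat else O.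
Proof.
rewrite /point_code; case: Nat.ltb_spec => h; first by have := prefix_le i k; lia.
by rewrite (sf_bit _ _ Hv) label_bit.
Qed.

(** At the end of the prefix both [point_code i y] and [v (label i y)] have shown an even number of
    1s; from there on they coincide. *)
Lemma code_even i k y : odd_ones (point_code i y) (l (fixed_bits i + k)) = false.
Proof.
rewrite -(sf_even _ _ Hv (fixed_bits i + k) (label i y)).
apply: (odd_ones_xor _ _ (prefix_length i)); first exact: prefix_le.
  by move=> n hn; rewrite /point_code; case: Nat.ltb_spec => //; lia.
case: i => [|i] //; rewrite [prefix_length _]/= (sf_even _ _ Hv).
have hsz : (sz i <= l (fixed_bits (S i)))%nat.
  by have := family_ge _ _ (fixed_bits (S i)) Hv; rewrite /fixed_bits /=; lia.
have pe n : (sz i <= n)%nat -> odd_ones (p i) n = false.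
  by elim: n / => [|n hn IH] //=; rewrite IH p_zero.
rewrite -(pe _ hsz); apply: (odd_ones_xor _ _ O) => //; first by lia.
by move=> n hn; rewrite /point_code /prefix_length; case: Nat.ltb_spec => //; lia.
Qed.

Lemma point_I01 i y : I01 (point i y).
Proof. exact: pt_I01. Qed.

Lemma point_lex i y y' : lex_lt y y' -> point i y < point i y'.
Proof.
move=> [k [h [h0 h1]]].
have [|||r [hr e]] := pt_first_diff (point_code i y) (point_code i y') (l (fixed_bits i + k)).
- by apply: code_agree_below.
- by rewrite code_bit h0.
- by rewrite code_bit h1.
rewrite code_even in e.
have hp : 0 < (/ 3) ^ l (fixed_bits i + k) by apply: pow_lt; lra.
have : 0 < r * (/ 3) ^ l (fixed_bits i + k) by apply: Rmult_lt_0_compat; lra.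
by rewrite /point; lra.
Qed.

Lemma point_cont i n y y' : agree n y y' -> Rabs (point i y - point i y') <= (/ 2) ^ n.
Proof.
move=> h; apply: pt_agree => k hk; apply: (code_agree_below _ _ _ _ h).
by have := family_ge _ _ (fixed_bits i + n) Hv; lia.
Qed.

Lemma point_dense a b : 0 <= a -> a < b -> b <= 1 -> exists i, forall y, a <= point i y <= b.
Proof.
move=> ha hab hb; have [w [n [hw hwab]]] := word_density a b ha hab hb.
have [m [w' [hm [hw' [hodd hag]]]]] : exists m w', (n <= m)%nat /\
    (forall k, (w' k <= 2)%nat) /\ odd_ones w' m = false /\
    forall k, (k < n)%nat -> w' k = w k.
  case E: (odd_ones w n); last by exists n, w.
  (* A further symbol 1 corrects the parity and only shrinks the branch image. *)
  exists (S n), (fun k => if (k =? n)%nat then 1%nat else w k).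
  split; first by lia.
  split; first by move=> k; case: Nat.eqb_spec => // _; lia.
  split=> [|k hk]; last by case: Nat.eqb_spec => //; lia.
  rewrite /= Nat.eqb_refl (odd_ones_xor _ w O n) ?E //; first by lia.
  by move=> k hk; case: Nat.eqb_spec => //; lia.
have [i [hsz hp]] := p_all w' m hw' hodd.
exists (S i) => y.
have e k : (k < n)%nat -> point_code (S i) y k = w k.
  move=> hk; rewrite /point_code; case: Nat.ltb_spec => [_|].
    by rewrite /= hp ?hag //; lia.
  have := family_ge _ _ (fixed_bits (S i)) Hv; rewrite /prefix_length /fixed_bits /=; lia.
have := hwab (pt (shift n (point_code (S i) y))) (pt_I01 _).
by rewrite -(branch_agree _ g3 _ w _ _ e) -(pt_branch _ n) -/(point (S i) y); lra.
Qed.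

Lemma point_tracks i y : tracks v (point i y) (label i y).
Proof.
exists (prefix_length i) => n hn; rewrite iter_pt; congr pt.
apply: functional_extensionality => k; rewrite /shift /point_code.
by case: Nat.ltb_spec => //; lia.
Qed.

Lemma point_label i i' y y' : point i y <> point i' y' -> label i y <> label i' y'.
Proof. by move=> h /label_inj [e e']; apply: h; rewrite e e'. Qed.

End Points.

(** * Transfer by conjugacy *)

Definition clamp (x : R) : R := Rmax 0 (Rmin x 1).

Lemma clamp_I01 x : I01 (clamp x).
Proof. by rewrite /clamp /I01; split; [exact: Rmax_l | apply: Rmax_lub; [lra | exact: Rmin_r]]. Qed.

Lemma clamp_id x : I01 x -> clamp x = x.
Proof. by move=> [? ?]; rewrite /clamp Rmin_left ?Rmax_right. Qed.

Lemma clamp_lip x y : Rabs (clamp x - clamp y) <= Rabs (x - y).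
Proof.
have cases z : (z <= 0 /\ clamp z = 0) \/ (0 <= z <= 1 /\ clamp z = z) \/ (1 <= z /\ clamp z = 1).
  rewrite /clamp; case: (Rle_lt_dec z 0) => h0; [|case: (Rle_lt_dec z 1) => h1].
  - by left; rewrite Rmin_left ?Rmax_left; lra.
  - by right; left; rewrite Rmin_left ?Rmax_right; lra.
  - by right; right; rewrite Rmin_right ?Rmax_right; lra.
by move: (cases x) (cases y) => [[? ->]|[[? ->]|[? ->]]] [[? ->]|[[? ->]|[? ->]]];
  rewrite /Rabs; repeat case: Rcase_abs => ?; lra.
Qed.

(** Composed with the retraction [clamp], [f] is continuous at the points of [0,1] as a function on
    the line, and the theorem of Heine applies. *)
Lemma cont01_uniform f : cont01 f -> forall eps, eps > 0 -> exists del, del > 0 /\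
  forall x y, I01 x -> I01 y -> Rabs (x - y) < del -> Rabs (f x - f y) < eps.
Proof.
move=> hf eps he.
have cont x : 0 <= x <= 1 -> continuity_pt (fun x => f (clamp x)) x.
  move=> _ e hpos; have [del [hd h]] := hf (clamp x) (clamp_I01 x) e hpos.
  exists del; split=> // y [_ hy]; apply: h; first exact: clamp_I01.
  by have := clamp_lip y x; rewrite /= /Rdist in hy *; lra.
have [del hdel] := Heine_cor2 cont (mkposreal eps he).
exists del; split; first exact: cond_pos.
by move=> x y hx hy h; have := hdel x y hx hy h; rewrite /= !clamp_id.
Qed.

Record conj_by (h hinv f g : R -> R) : Prop := {
  cb_f : cmap01 f;
  cb_g : cmap01 g;
  cb_h : cmap01 h;
  cb_hinv : cmap01 hinv;
  cb_K : forall x, I01 x -> hinv (h x) = x;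
  cb_Kinv : forall y, I01 y -> h (hinv y) = y;
  cb_conj : forall x, I01 x -> h (f x) = g (h x) }.

Lemma cmap01_comp f g : cmap01 f -> cmap01 g -> cmap01 (fun x => f (g x)).
Proof.
move=> [cf If] [cg Ig]; split=> [x hx eps he|x hx]; last by auto.
have [d [hd h]] := cf (g x) (Ig x hx) eps he; have [d' [hd' h']] := cg x hx d hd.
by exists d'; split=> // y hy hyx; apply: h; auto.
Qed.

Lemma conj_by_sym h hinv f g : conj_by h hinv f g -> conj_by hinv h g f.
Proof.
move=> [cf cg ch ci K K' C]; split=> // y hy.
have hiy := proj2 ci y hy.
by rewrite -{1}(K' y hy) -C // K //; apply: (proj2 cf).
Qed.

Lemma conj_by_exists h hinv f : cmap01 f -> cmap01 h -> cmap01 hinv ->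
  (forall x, I01 x -> hinv (h x) = x) -> (forall y, I01 y -> h (hinv y) = y) ->
  conj_by h hinv f (fun y => h (f (hinv y))).
Proof.
move=> cf ch ci K K'; split=> // [|x hx]; last by rewrite K.
exact: cmap01_comp ch (cmap01_comp _ _ cf ci).
Qed.

Lemma conj_by_top_conj h hinv k kinv f g g' : conj_by h hinv f g -> conj_by k kinv f g' ->
  top_conj g g'.
Proof.
move=> H H'; exists (fun x => k (hinv x)), (fun x => h (kinv x)).
have S := conj_by_sym _ _ _ _ H.
have ih x : I01 x -> I01 (h x) by exact: (proj2 (cb_h _ _ _ _ H)).
have ihi x : I01 x -> I01 (hinv x) by exact: (proj2 (cb_hinv _ _ _ _ H)).
have ik x : I01 x -> I01 (k x) by exact: (proj2 (cb_h _ _ _ _ H')).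
have iki x : I01 x -> I01 (kinv x) by exact: (proj2 (cb_hinv _ _ _ _ H')).
split; [|split; [|split; [|split]]].
- exact: cmap01_comp (cb_h _ _ _ _ H') (cb_hinv _ _ _ _ H).
- exact: cmap01_comp (cb_h _ _ _ _ H) (cb_hinv _ _ _ _ H').
- by move=> x hx; rewrite (cb_K _ _ _ _ H') ?(cb_Kinv _ _ _ _ H) //; exact: ihi.
- by move=> x hx; rewrite (cb_K _ _ _ _ H) ?(cb_Kinv _ _ _ _ H') //; exact: iki.
- move=> x hx; rewrite (cb_conj _ _ _ _ S) // (cb_conj _ _ _ _ H') //; exact: ihi.
Qed.

Section Transfer.
Variables (h hinv f g : R -> R).
Hypothesis H : conj_by h hinv f g.

Lemma conj_h_I01 x : I01 x -> I01 (h x).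
Proof. exact: (proj2 (cb_h _ _ _ _ H)). Qed.

Lemma conj_hinv_I01 x : I01 x -> I01 (hinv x).
Proof. exact: (proj2 (cb_hinv _ _ _ _ H)). Qed.

Lemma conj_iter_I01 n x : I01 x -> I01 (iter n f x).
Proof. by elim: n => //= n IH hx; apply: (proj2 (cb_f _ _ _ _ H)); apply: IH. Qed.

Lemma conj_iter n x : I01 x -> iter n g (h x) = h (iter n f x).
Proof.
by move=> hx; elim: n => //= n ->; rewrite (cb_conj _ _ _ _ H) //; exact: conj_iter_I01.
Qed.

Lemma conj_proximal d x : (forall j, (j < d)%nat -> I01 (x j)) ->
  proximal f d x -> proximal g d (fun j => h (x j)).
Proof.
move=> hx hprox eps he N.
have [del [hd hu]] := cont01_uniform h (proj1 (cb_h _ _ _ _ H)) eps he.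
have [n [hn hc]] := hprox del hd N; exists n; split=> // i j hi hj.
rewrite !conj_iter; try exact: hx.
by apply: hu; try (apply: conj_iter_I01; exact: hx); exact: hc.
Qed.

(** By uniform continuity of [hinv], images closer than its modulus would come from points closer
    than [eta]. Hence [delta] is fixed before the tuple. *)
Lemma conj_separated eta : 0 < eta -> exists delta, 0 < delta /\ forall d x,
  (forall j, (j < d)%nat -> I01 (x j)) ->
  (forall N, exists n, (n >= N)%nat /\ forall i j, (i < d)%nat -> (j < d)%nat -> i <> j ->
     eta <= Rabs (iter n f (x i) - iter n f (x j))) ->
  separated g d (fun j => h (x j)) delta.
Proof.
move=> heta.
have [del [hd hu]] := cont01_uniform hinv (proj1 (cb_hinv _ _ _ _ H)) eta heta.
(* [del / 3 < del / 2 < del] leaves room for both strict inequalities in [separated]. *)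
exists (del / 3); split=> [|d x hx hsep]; first by lra.
exists (del / 2); split=> [|N]; first by lra.
have [n [hn hc]] := hsep N; exists n; split=> // i j hi hj hij.
rewrite !conj_iter; try exact: hx.
apply: Rnot_le_lt => hle.
have hI k : (k < d)%nat -> I01 (iter n f (x k)) by move=> hk; apply: conj_iter_I01; auto.
have := hu (h (iter n f (x i))) (h (iter n f (x j))).
rewrite !(cb_K _ _ _ _ H) //; auto => hlt.
have := hlt (conj_h_I01 _ (hI i hi)) (conj_h_I01 _ (hI j hj)) ltac:(lra).
by have := hc i j hi hj hij; lra.
Qed.

Lemma conj_LiYorke_pair x y : I01 x -> I01 y -> LiYorke_pair f x y -> LiYorke_pair g (h x) (h y).
Proof.
move=> hx hy [hprox [delta [hd [eta [he hsep]]]]].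
have hI j : (j < 2)%nat -> I01 (pair2 x y j) by case: j.
have e : pair2 (h x) (h y) = (fun j => h (pair2 x y j)).
  by apply: functional_extensionality; case.
rewrite /LiYorke_pair e; split; first exact: conj_proximal.
have [delta' [hd' hc]] := conj_separated eta ltac:(lra).
exists delta'; split=> //; apply: hc => // N; have [n [hn h1]] := hsep N.
by exists n; split=> // i j hi hj hij; have := h1 i j hi hj hij; lra.
Qed.

Lemma conj_omega x y : I01 x -> I01 y -> omega_limit f x y -> omega_limit g (h x) (h y).
Proof.
move=> hx hy hom eps he N.
have [del [hd hc]] := proj1 (cb_h _ _ _ _ H) y hy eps he.
have [n [hn hl]] := hom del hd N; exists n; split=> //.
by rewrite conj_iter //; apply: hc => //; exact: conj_iter_I01.
Qed.

Definition image01 (A : R -> Prop) (z : R) : Prop := I01 z /\ A (hinv z).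

Lemma image01_closed A : (forall x, A x -> I01 x) -> Defs.closed_set A ->
  Defs.closed_set (image01 A).
Proof.
move=> hA hc z hz.
have hzI : I01 z.
  split; apply: Rnot_lt_le => hlt.
  - by have [a [[[? ?] _] /Rabs_def2]] := hz (- z) ltac:(lra); lra.
  - by have [a [[[? ?] _] /Rabs_def2]] := hz (z - 1) ltac:(lra); lra.
split=> //; apply: hc => eps he.
have [del [hd hcont]] := proj1 (cb_hinv _ _ _ _ H) z hzI eps he.
have [a [[ha hAa] hza]] := hz del hd.
by exists (hinv a); split=> //; apply: hcont.
Qed.

Lemma image01_invariant A : invariant f A -> invariant g (image01 A).
Proof.
move=> hA z [hz hAz]; split; first exact: (proj2 (cb_g _ _ _ _ H)).
by rewrite (cb_conj _ _ _ _ (conj_by_sym _ _ _ _ H)) //; apply: hA.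
Qed.

Lemma image01_cantor A : cantor_set A -> cantor_set (image01 A).
Proof.
move=> [[a ha] [hI [hc [hperf hgap]]]].
split; [|split; [by move=> z [] | split; [exact: image01_closed | split]]].
- exists (h a); split; first exact/conj_h_I01/hI.
  by rewrite (cb_K _ _ _ _ H) //; apply: hI.
- move=> z [hz hAz] eps he.
  have [del [hd hcont]] := proj1 (cb_h _ _ _ _ H) (hinv z) (hI _ hAz) eps he.
  have [y [hy [hne hyz]]] := hperf _ hAz del hd.
  exists (h y); split; [split|split].
  + exact/conj_h_I01/hI.
  + by rewrite (cb_K _ _ _ _ H) //; apply: hI.
  + by move=> e; apply: hne; rewrite -e (cb_K _ _ _ _ H) //; apply: hI.
  + by have := hcont y (hI _ hy) hyz; rewrite (cb_Kinv _ _ _ _ H).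
- move=> s t hst.
  case: (classic (I01 ((s + t) / 2))) => hm; last first.
    by exists ((s + t) / 2); split; [lra | move=> []].
  have [del [hd hcont]] := proj1 (cb_h _ _ _ _ H) (hinv ((s + t) / 2)) (conj_hinv_I01 _ hm)
    ((t - s) / 2) ltac:(lra).
  rewrite (cb_Kinv _ _ _ _ H) // in hcont.
  set x := hinv ((s + t) / 2) in hcont.
  have [hx0 hx1] : I01 x by exact: conj_hinv_I01.
  (* A point outside [A] near the preimage of the midpoint; continuity of [h] sends it into the
     interval. *)
  have [w [[hw1 hw2] hwA]] := hgap (Rmax 0 (x - del)) (Rmin 1 (x + del))
    ltac:(by apply: Rmax_lub_lt; apply: Rmin_glb_lt; lra).
  have m1 := Rmax_l 0 (x - del); have m2 := Rmax_r 0 (x - del).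
  have m3 := Rmin_l 1 (x + del); have m4 := Rmin_r 1 (x + del).
  have hwI : I01 w by rewrite /I01; lra.
  have /Rabs_def2 hwm := hcont w hwI ltac:(by apply: Rabs_def1; lra).
  exists (h w); split; first by lra.
  by move=> [_]; rewrite (cb_K _ _ _ _ H).
Qed.

Lemma image01_minimal A : (forall x, A x -> I01 x) -> minimal_set f A -> minimal_set g (image01 A).
Proof.
move=> hI [[a ha] [hc [hinva hmin]]].
split; [|split; [exact: image01_closed | split; [exact: image01_invariant|]]].
  exists (h a); split; first exact/conj_h_I01/hI.
  by rewrite (cb_K _ _ _ _ H) //; apply: hI.
move=> B [b hb] hBc hBi hBs z [hz hAz].
suff : I01 (hinv z) /\ B (h (hinv z)) by rewrite (cb_Kinv _ _ _ _ H) // => -[].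
(* Minimality is applied to the preimage of [B] under [h]. *)
apply: (hmin (fun x => I01 x /\ B (h x))) hAz.
- have [hbI hbA] := hBs b hb; exists (hinv b); rewrite (cb_Kinv _ _ _ _ H) //.
  by split=> //; exact: hI.
- move=> x hx.
  have hxA : A x.
    apply: hc => eps he; have [y [[hy hBy] hyx]] := hx eps he; exists y; split=> //.
    by have [_] := hBs _ hBy; rewrite (cb_K _ _ _ _ H).
  split; first exact: hI.
  apply: hBc => eps he.
  have [del [hd hcont]] := proj1 (cb_h _ _ _ _ H) x (hI _ hxA) eps he.
  have [y [[hy hBy] hyx]] := hx del hd.
  by exists (h y); split=> //; apply: hcont.
- move=> x [hx hBx]; split; first exact: (proj2 (cb_f _ _ _ _ H)).
  by rewrite (cb_conj _ _ _ _ H) //; apply: hBi.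
- by move=> x [hx /hBs [_]]; rewrite (cb_K _ _ _ _ H).
Qed.

End Transfer.

Lemma null1_sub (E F : R -> Prop) : (forall x, E x -> F x) -> null1 F -> null1 E.
Proof.
move=> hs hF eps /hF [a [b [h1 [h2 h3]]]]; exists a, b; split=> //; split=> // x /hs; exact: h2.
Qed.

(** One cover of [N] of length [eps / 2] is used in both directions, its intervals being thickened
    to strips of unit width. *)
Lemma null2_outside_square (N : R -> Prop) (E : R -> R -> Prop) : null1 N ->
  (forall x y, E x y -> I01 x /\ I01 y /\ (N x \/ N y)) -> null2 E.
Proof.
move=> hN hE eps he; have [a [b [h1 [h2 h3]]]] := hN (eps / 2) ltac:(lra).
pose z : nat -> R := fun _ => 0; pose o : nat -> R := fun _ => 1.
have hle n : interleave a z n <= interleave b o n /\ interleave z a n <= interleave o b n.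
  by rewrite /interleave /z /o; case: Nat.even; split=> //; lra.
exists (interleave a z), (interleave b o), (interleave z a), (interleave o b).
split; [by [] | split].
- move=> x y /hE [hx [hy [/h2 [n hn]|/h2 [n hn]]]].
  + by exists (2 * n)%nat; rewrite !interleave_even.
  + by exists (2 * n + 1)%nat; rewrite !interleave_odd.
- move=> n; rewrite sum_f_R0_sumn.
  apply: (sumn_interleave _ (fun k => b k - a k) (fun k => b k - a k)) => k.
  + by have [? ?] := hle k; apply: Rmult_le_pos; lra.
  + by rewrite !interleave_even /z /o; lra.
  + by rewrite !interleave_odd /z /o; lra.
  + case: k => [|k]; first by rewrite /=; lra.
    by rewrite -sum_f_R0_sumn; have := h3 k; lra.
Qed.

(** * From a symbol family to a conjugate of [zig] *)

Lemma choose_points (psi : nat -> (nat -> bool) -> R) d (x : nat -> R) :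
  (forall j, (j < d)%nat -> exists i y, psi i y = x j) ->
  exists i y, forall j, (j < d)%nat -> psi (i j) (y j) = x j.
Proof.
move=> h.
have [q hq] : exists q : nat -> nat * (nat -> bool), forall j, (j < d)%nat ->
    psi (fst (q j)) (snd (q j)) = x j.
  apply: (choice (fun j (q : nat * (nat -> bool)) =>
    (j < d)%nat -> psi (fst q) (snd q) = x j)) => j.
  case: (classic (j < d)%nat) => hj; last by exists (O, fun _ => false).
  by have [i [y e]] := h j hj; exists (i, y).
by exists (fun j => fst (q j)), (fun j => snd (q j)).
Qed.

(** All that is needed of the points and the homeomorphism, in a form that applies to the three
    families in turn. The clause on [psi O] will put the first Cantor set, whose image is not null,
    into the minimal set. *)
Lemma family_model v l : symbol_family v l -> exists
  (psi : nat -> (nat -> bool) -> R) (lab : nat -> (nat -> bool) -> nat -> bool)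
  (h hinv g : R -> R),
  conj_by h hinv zig g /\
  (forall i y, I01 (psi i y)) /\
  (forall i y, tracks v (psi i y) (lab i y)) /\
  (forall i i' y y', psi i y <> psi i' y' -> lab i y <> lab i' y') /\
  (forall y, psi O y = pt (v (lab O y))) /\
  full_measure01 (fun z => I01 z /\ exists i y, psi i y = hinv z) /\
  ~ null1 (fun z => I01 z /\ exists y, psi O y = hinv z).
Proof.
move=> Hv; have [p [sz [p_even [p_zero p_all]]]] := Words.even_words.
have [||||h [hinv [ch [ci [K [K' [hfull hpos]]]]]]] := measure_homeo (point v l p sz).
- exact: point_I01.
- exact: point_lex Hv p sz p_even p_zero.
- exact: point_cont Hv p sz.
- exact: point_dense Hv p sz p_all.
exists (point v l p sz), (label sz), h, hinv, (fun y => h (zig (hinv y))).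
split; first exact: conj_by_exists zig_cmap01 ch ci K K'.
split; first exact: point_I01.
split; first by move=> i y; exact: point_tracks.
split; first by move=> i i' y y'; exact: point_label.
by split.
Qed.

(** [delta d] stems from the separation [3^-(l d + 1)] for [zig], which is known before any tuple is
    given. *)
Lemma family_scrambled v l (psi : nat -> (nat -> bool) -> R) lab h hinv g :
  symbol_family v l -> block_prop v ->
  conj_by h hinv zig g -> (forall i y, I01 (psi i y)) ->
  (forall i y, tracks v (psi i y) (lab i y)) ->
  (forall i i' y y', psi i y <> psi i' y' -> lab i y <> lab i' y') ->
  exists delta : nat -> R, (forall d, 0 < delta d) /\
    forall d x, (forall i, (i < d)%nat -> I01 (x i) /\ exists j y, psi j y = hinv (x i)) ->
    (forall i j, (i < d)%nat -> (j < d)%nat -> i <> j -> x i <> x j) ->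
    proximal g d x /\ separated g d x (delta d).
Proof.
move=> Hv Hb C psiI tr inj.
have hsep d := conj_separated _ _ _ _ C ((/ 3) ^ S (l d)) ltac:(apply: pow_lt; lra).
have [delta hdelta] := choice _ hsep.
exists delta; split=> [d|d x hx hne]; first by have [] := hdelta d.
have [i [y hiy]] := choose_points psi d (fun j => hinv (x j)) (fun j hj => proj2 (hx j hj)).
pose q j := psi (i j) (y j); pose c j := lab (i j) (y j).
have hq j : (j < d)%nat -> h (q j) = x j.
  by move=> hj; rewrite /q hiy // (cb_Kinv _ _ _ _ C) //; have [] := hx j hj.
have htr j : (j < d)%nat -> tracks v (q j) (c j) by move=> _; exact: tr.
have hc j k : (j < d)%nat -> (k < d)%nat -> j <> k -> c j <> c k.
  move=> hj hk hjk; apply: inj => e; apply: (hne j k hj hk hjk).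
  by rewrite -(hq j hj) -(hq k hk) /q e.
have hqI j : (j < d)%nat -> I01 (q j) by move=> _; exact: psiI.
have hprox := conj_proximal _ _ _ _ C d q hqI (scrambled_proximal v Hb d q c htr).
have [_ hs] := hdelta d.
have hs' := hs d q hqI (scrambled_separated v l Hv Hb d q c htr hc).
split.
- move=> eps he N; have [n [hn h1]] := hprox eps he N; exists n; split=> // j k hj hk.
  by have := h1 j k hj hk; rewrite !hq.
- have [eta [he h1]] := hs'; exists eta; split=> // N; have [n [hn h2]] := h1 N.
  by exists n; split=> // j k hj hk hjk; have := h2 j k hj hk hjk; rewrite !hq.
Qed.

Theorem theoremC :
  exists (P S T : R -> R) (K L M : R -> Prop) (delta : nat -> R),
    cmap01 P /\ cmap01 S /\ cmap01 T /\
    top_conj P S /\ top_conj S T /\ top_conj P T /\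
    (forall d, (d >= 2)%nat -> delta d > 0) /\
    (* (1) *)
    full_measure01 K /\ full_measure01 L /\ full_measure01 M /\
    (* (2) *)
    (forall d, (d >= 2)%nat -> forall x : nat -> R,
       (forall i, (i < d)%nat -> L (x i)) ->
       (forall i j, (i < d)%nat -> (j < d)%nat -> i <> j -> x i <> x j) ->
       delta_LiYorke S d x (delta d)) /\
    (forall d, (d >= 2)%nat -> forall x : nat -> R,
       (forall i, (i < d)%nat -> M (x i)) ->
       (forall i j, (i < d)%nat -> (j < d)%nat -> i <> j -> x i <> x j) ->
       delta_LiYorke T d x (delta d)) /\
    (* (3) *)
    (forall x, L x -> forall y, omega_limit S x y <-> I01 y) /\
    (* (4) *)
    (exists A : R -> Prop, cantor_set A /\ positive_measure A /\ minimal_set T A /\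
       forall x, M x -> forall y, omega_limit T x y <-> A y) /\
    (* (5) *)
    (forall x y, K x -> K y -> ~ LiYorke_pair P x y) /\
    null2 (fun x y => I01 x /\ I01 y /\ LiYorke_pair P x y).
Proof.
have [vK [lK [HK [K_ne1 K_distal]]]] := Words.distal_family.
have [vL [lL [HL [L_block L_words]]]] := Words.transitive_family.
have [vM [lM [HM [M_block [M_ne1 M_rec]]]]] := Words.minimal_family.
have [pK [labK [hK [kK [P [CK [IK [trK [injK [_ [fullK _]]]]]]]]]]] := family_model _ _ HK.
have [pL [labL [hL [kL [S [CL [IL [trL [injL [_ [fullL _]]]]]]]]]]] := family_model _ _ HL.
have [pM [labM [hM [kM [T [CM [IM [trM [injM [pM0 [fullM posM]]]]]]]]]]] := family_model _ _ HM.
have [dL [dL0 scrL]] := family_scrambled _ _ _ _ _ _ _ HL L_block CL IL trL injL.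
have [dM [dM0 scrM]] := family_scrambled _ _ _ _ _ _ _ HM M_block CM IM trM injM.
pose K z := I01 z /\ exists i y, pK i y = kK z.
(* Equal labels make the orbits merge, which excludes separation; different labels exclude
   proximality. *)
have noLY x y : K x -> K y -> ~ LiYorke_pair P x y.
  move=> [hx [i [s hs]]] [hy [j [t ht]]] hLY.
  have := conj_LiYorke_pair _ _ _ _ (conj_by_sym _ _ _ _ CK) x y hx hy hLY.
  rewrite -hs -ht => -[hprox [delta [hd hsep]]].
  case: (classic (labK i s = labK j t)) => e.
  - apply: equal_labels_not_separated hd (trK i s) _ hsep; rewrite e; exact: trK.
  - exact: distal_not_proximal HK K_ne1 K_distal _ _ _ _ (trK i s) (trK j t) e hprox.
(* The same numbers have to serve [S] and [T], so the smaller of the two separations is taken. *)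
have weaken g d x e e' : e' <= e -> separated g d x e -> separated g d x e'.
  by move=> hle [eta [he h]]; exists eta; split=> //; lra.
exists P, S, T, K, (fun z => I01 z /\ exists i y, pL i y = kL z),
  (fun z => I01 z /\ exists i y, pM i y = kM z), (fun d => Rmin (dL d) (dM d)).
split; first exact: cb_g CK.
split; first exact: cb_g CL.
split; first exact: cb_g CM.
split; first exact: conj_by_top_conj CK CL.
split; first exact: conj_by_top_conj CL CM.
split; first exact: conj_by_top_conj CK CM.
split; first by move=> d _; apply: Rmin_pos.
split=> //; split=> //; split=> //.
split.
  move=> d _ x hx hne; have [h1 h2] := scrL d x hx hne.
  by split=> //; apply: weaken h2; exact: Rmin_l.
split.
  move=> d _ x hx hne; have [h1 h2] := scrM d x hx hne.
  by split=> //; apply: weaken h2; exact: Rmin_r.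
split.
  move=> x [hx [i [s hs]]] y; split=> [|hy].
    apply: omega_I01 => n; exact: conj_iter_I01 (conj_by_sym _ _ _ _ CL) n x hx.
  have hk : omega_limit zig (pL i s) (kL y).
    apply/(transitive_omega _ L_words _ _ _ (IL i s) (trL i s)).
    exact: conj_hinv_I01 CL y hy.
  have := conj_omega _ _ _ _ CL _ _ (IL i s) (conj_hinv_I01 _ _ _ _ CL y hy) hk.
  by rewrite hs !(cb_Kinv _ _ _ _ CL).
split.
  have hA01 := min_set_I01 vM.
  exists (image01 kM (min_set vM)); split; [|split; [|split]].
  - exact: image01_cantor CM _ (min_set_cantor vM lM HM M_block M_ne1 M_rec).
  - move=> hnull; apply: posM; apply: null1_sub hnull => z [hz [y hy]]; split=> //.
    by rewrite -hy pM0; exact: pt_min_set.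
  - exact: image01_minimal CM _ hA01 (min_set_minimal vM M_rec).
  - move=> x [hx [i [s hs]]] y; split=> [hom|[hy hmin]].
    + have hy : I01 y.
        apply: omega_I01 hom => n; exact: conj_iter_I01 (conj_by_sym _ _ _ _ CM) n x hx.
      split=> //; apply/(omega_tracks vM M_rec _ _ _ (trM i s)); rewrite hs.
      exact: conj_omega (conj_by_sym _ _ _ _ CM) _ _ hx hy hom.
    + have hk : omega_limit zig (pM i s) (kM y).
        by apply/(omega_tracks vM M_rec _ _ _ (trM i s)).
      have := conj_omega _ _ _ _ CM _ _ (IM i s) (conj_hinv_I01 _ _ _ _ CM y hy) hk.
      by rewrite hs !(cb_Kinv _ _ _ _ CM).
split=> //.
apply: (null2_outside_square (fun z => I01 z /\ ~ K z)); first exact: (proj2 fullK).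
move=> x y [hx [hy hLY]]; split=> //; split=> //.
case: (classic (K x)) => hKx; last by left.
by right; split=> // hKy; apply: (noLY x y).
Qed.
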